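(* Let $\Omega$ be a finite set of cardinality greater than three, let $F\le F'\le\mathrm{Sym}(\Omega)$ be permutation groups such that $F$ acts freely on $\Omega$, and let $T$ be the $|\Omega|$-regular tree. (i) The collection of point stabilizers for the action of $G(F,F')$ on its Furstenberg boundary is exactly the collection of subgroups $G(F,F')_\xi^0$, $\xi\in\partial T$. (ii) An element $g\in G(F,F')$ fixes a point in the Furstenberg boundary of $G(F,F')$ if and only if $g$ fixes (pointwise) a half-tree of $T$, or equivalently if and only if $g$ is elliptic and $g$ fixes a point in $\partial T$.
   Context: Let $T$ be a $|\Omega|$-regular tree with set of ends $\partial T$, with a fixed colouring $c\colon E(T)\to\Omega$ of its edges such that for every vertex $v$, $c$ induces a bijection $c_v$ from the set of edges around $v$ to $\Omega$. For $g\in\mathrm{Aut}(T)$ and a vertex $v$, the local permutation is $\sigma(g,v)=c_{gv}\circ g_v\circ c_v^{-1}\in\mathrm{Sym}(\Omega)$, where $g_v$ is the bijection induced by $g$ from edges around $v$ to edges around $gv$. $G(F,F')$ is the (countable) group of $g\in\mathrm{Aut}(T)$ with $\sigma(g,v)\in F'$ for all vertices $v$ and $\sigma(g,v)\in F$ for all but finitely many $v$. For $\xi\in\partial T$, $G(F,F')^0_\xi$ is the set of elements of $G(F,F')$ fixing pointwise a neighbourhood of $\xi$ in $\partial T$. Any edge of $T$ separates $T$ into two subtrees called half-trees. An automorphism of $T$ is elliptic if it stabilizes a vertex or an edge. A boundary action of a countable group $G$ is an action by homeomorphisms on a compact Hausdorff space $X$ that is minimal (every orbit is dense) and strongly proximal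 (the closure of the orbit of every probability measure on $X$ contains a Dirac mass). The Furstenberg boundary $\partial_FG$ is the compact space with boundary action of $G$, unique up to $G$-equivariant homeomorphism, such that for every boundary action $G\curvearrowright X$ there is a continuous surjective $G$-equivariant map $\partial_FG\to X$. *)

(* Defs.v *)
From HB Require Import structures.
From mathcomp Require Import all_boot all_order all_algebra all_fingroup.
From mathcomp Require Import all_classical all_reals all_analysis.

Set Implicit Arguments.
Unset Strict Implicit.
Unset Printing Implicit Defensive.

Import numFieldNormedType.Exports.

Local Open Scope classical_set_scope.

Record tree := Tree {
  vertex :> choiceType ;
  adj : rel vertex ;
  tree_nonempty : inhabited vertex ;
  adj_sym : symmetric adj ;
  adj_irr : irreflexive adj ;
  tree_connected : forall x y, exists2 p, path adj x p & last x p = y ;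
  tree_acyclic : forall p : seq vertex, uniq p -> path.cycle adj p -> (size p < 3)%N
}.

Definition regular_tree (n : nat) (T : tree) : Prop :=
  forall v : T, ([set w | adj v w] #= `I_n)%card.

Section tree_automorphisms.
Variable T : tree.

Record tree_aut := TreeAut {
  aut_fun :> T -> T ;
  aut_bij : bijective aut_fun ;
  aut_adj : {mono aut_fun : x y / adj x y}
}.

HB.instance Definition _ := gen_eqMixin tree_aut.
HB.instance Definition _ := gen_choiceMixin tree_aut.

Lemma tree_autP (g h : tree_aut) : g =1 h -> g = h.
Proof.
case: g h => [g bg ag] [h bh ah] /= /funext gh; subst h.
by congr TreeAut; apply: Prop_irrelevance.
Qed.

Definition aut_one : tree_aut :=
  @TreeAut id (@Bijective _ _ id id (frefl _) (frefl _)) (fun _ _ => erefl).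

Definition aut_mul (g h : tree_aut) : tree_aut.
Proof.
exists (g \o h); first exact: (bij_comp (aut_bij g) (aut_bij h)).
by move=> x y /=; rewrite !aut_adj.
Defined.

Lemma aut_inv_subproof (g : tree_aut) :
  exists f : T -> T, cancel g f /\ cancel f g.
Proof. by case: (aut_bij g) => f; exists f. Qed.

Definition aut_inv_fun (g : tree_aut) : T -> T := sval (cid (aut_inv_subproof g)).

Lemma aut_invK (g : tree_aut) : cancel g (aut_inv_fun g).
Proof. by rewrite /aut_inv_fun; case: cid => f []. Qed.

Lemma aut_Kinv (g : tree_aut) : cancel (aut_inv_fun g) g.
Proof. by rewrite /aut_inv_fun; case: cid => f []. Qed.

Definition aut_inv (g : tree_aut) : tree_aut.
Proof.
exists (aut_inv_fun g); first exact: Bijective (@aut_Kinv g) (@aut_invK g).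
by move=> x y; rewrite -(aut_adj g) !aut_Kinv.
Defined.

Fact aut_mulA : associative aut_mul.
Proof. by move=> f g h; apply: tree_autP. Qed.
Fact aut_mul1 : left_id aut_one aut_mul.
Proof. by move=> f; apply: tree_autP. Qed.
Fact aut_1mul : right_id aut_one aut_mul.
Proof. by move=> f; apply: tree_autP. Qed.
Fact aut_mulV : left_inverse aut_one aut_inv aut_mul.
Proof. by move=> f; apply: tree_autP => x /=; rewrite aut_invK. Qed.
Fact aut_Vmul : right_inverse aut_one aut_inv aut_mul.
Proof. by move=> f; apply: tree_autP => x /=; rewrite aut_Kinv. Qed.

HB.instance Definition _ := isGroup.Build tree_aut
  aut_mulA aut_mul1 aut_1mul aut_mulV aut_Vmul.

(* The half-tree containing [y] among the two components left when the edge
   [{x, y}] is removed. *)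
Definition half_tree (x y : T) : set T :=
  [set v | exists2 p,
     path [rel u w | adj u w && ([set u; w] != [set x; y])] y p
     & last y p = v].

Definition is_half_tree (H : set T) : Prop :=
  exists x y : T, adj x y /\ H = half_tree x y.

Definition fixes_half_tree (g : tree_aut) : Prop :=
  exists2 H, is_half_tree H & forall v, H v -> g v = v.

Definition elliptic (g : tree_aut) : Prop :=
  (exists v : T, g v = v) \/
  (exists v w : T, adj v w /\ g @` [set v; w] = [set v; w]).

Definition ray (r : nat -> T) : Prop :=
  injective r /\ forall n, adj (r n) (r n.+1).

Definition cofinal_rays (r s : nat -> T) : Prop :=
  exists m n, forall k, r (m + k)%N = s (n + k)%N.

(* Ends are the cofinality classes of rays. *)
Record tree_end := TreeEnd {
  end_rays : set (nat -> T) ;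
  end_raysP : exists2 r, ray r &
    end_rays = [set s | ray s /\ cofinal_rays r s]
}.

Lemma tree_endP (xi eta : tree_end) : end_rays xi = end_rays eta -> xi = eta.
Proof.
case: xi eta => [E PE] [E' PE'] /= EE'; subst E'.
by congr TreeEnd; apply: Prop_irrelevance.
Qed.

HB.instance Definition _ := gen_eqMixin tree_end.
HB.instance Definition _ := gen_choiceMixin tree_end.

Definition ends_of (H : set T) : set tree_end :=
  [set xi | exists2 r, end_rays xi r & forall n, H (r n)].

HB.instance Definition _ :=
  @isSubBaseTopological.Build tree_end (set T) is_half_tree ends_of.

Lemma end_map_subproof (g : tree_aut) (xi : tree_end) :
  exists2 r, ray r &
    [set g \o s | s in end_rays xi] = [set s | ray s /\ cofinal_rays r s].
Proof.
have gray (h : tree_aut) r : ray r -> ray (h \o r).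
  move=> [rinj radj]; split=> [|n /=]; last by rewrite aut_adj.
  exact: inj_comp (bij_inj (aut_bij h)) rinj.
case: (end_raysP xi) => r rr ->; exists (g \o r); first exact: gray.
apply/seteqP; split=> [_ [s [rs [m [n mn]]] <-]|s [rs [m [n mn]]]] /=.
  by split; [exact: gray | exists m, n => k /=; rewrite mn].
exists (aut_inv g \o s); last by apply/funext => k /=; rewrite aut_Kinv.
split; first exact: gray.
by exists m, n => k /=; rewrite -mn /= aut_invK.
Qed.

Definition end_map (g : tree_aut) (xi : tree_end) : tree_end :=
  TreeEnd (end_map_subproof g xi).

End tree_automorphisms.

(* An edge colouring is a function of the two endpoints of the edge; its values
   on pairs of non-adjacent vertices are never used. *)
Record colouring (T : tree) (Omega : finType) := Colouring {
  colour :> T -> T -> Omega ;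
  colour_sym : forall v w, adj v w -> colour v w = colour w v ;
  colour_bij : forall v, set_bij [set w | adj v w] [set: Omega] (colour v)
}.

Section almost_prescribed_local_action.
Variables (T : tree) (Omega : finType) (c : colouring T Omega).

Lemma nbr_subproof v a : exists w, adj v w /\ c v w = a.
Proof.
have [_ _ /(_ a Logic.I)[w vw <-]] := colour_bij c v.
by exists w.
Qed.

(* The inverse of [c v], as the map sending a colour [a] to the vertex at the
   other end of the edge of colour [a] at [v]. *)
Definition nbr (v : T) (a : Omega) : T := sval (cid (nbr_subproof v a)).

Lemma nbr_adj v a : adj v (nbr v a).
Proof. by rewrite /nbr; case: cid => w []. Qed.

Lemma colour_nbr v a : c v (nbr v a) = a.
Proof. by rewrite /nbr; case: cid => w []. Qed.

Lemma colour_inj v w w' : adj v w -> adj v w' -> c v w = c v w' -> w = w'.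
Proof.
have [_ cinj _] := colour_bij c v.
by move=> vw vw'; apply: cinj; rewrite inE.
Qed.

Lemma nbr_colour v w : adj v w -> nbr v (c v w) = w.
Proof. by move=> vw; apply: (@colour_inj v); rewrite ?nbr_adj ?colour_nbr. Qed.

Lemma local_perm_subproof (g : tree_aut T) v :
  injective (fun a => c (g v) (g (nbr v a))).
Proof.
move=> a b /colour_inj; rewrite !aut_adj !nbr_adj => /(_ isT isT).
by move=> /(bij_inj (aut_bij g)) /(congr1 (c v)); rewrite !colour_nbr.
Qed.

Definition local_perm (g : tree_aut T) (v : T) : {perm Omega} :=
  perm (@local_perm_subproof g v).

Lemma local_perm1 v : local_perm 1%g v = 1%g.
Proof. by apply/permP => a; rewrite permE perm1 /= colour_nbr. Qed.

(* The product of [{perm Omega}] composes from left to right, that of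
   [tree_aut T] from right to left. *)
Lemma local_permM g h v :
  local_perm (g * h)%g v = (local_perm h v * local_perm g (h v))%g.
Proof.
by apply/permP => a; rewrite permM !permE /= nbr_colour// aut_adj nbr_adj.
Qed.

Lemma local_permV g v : local_perm g^-1%g v = ((local_perm g (g^-1%g v))^-1)%g.
Proof.
apply: (mulIg (local_perm g (g^-1%g v))).
by rewrite mulVg -local_permM mulgV local_perm1.
Qed.

Variables F F' : {group {perm Omega}}.

Definition GFF_pred : {pred tree_aut T} :=
  [pred g | `[< (forall v, local_perm g v \in F') /\
                finite_set [set v | local_perm g v \notin F] >]].

Fact GFF_group_closed : group_closed GFF_pred.
Proof.
have GFF1 : 1%g \in GFF_pred.
  apply/asboolP; split=> [v|]; first by rewrite local_perm1 group1.
  by rewrite (_ : mkset _ = set0)// -subset0 => v /=; rewrite local_perm1 group1.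
have GFFV g : g \in GFF_pred -> g^-1%g \in GFF_pred.
  move=> /asboolP[gF' gF]; apply/asboolP; split=> [v|].
    by rewrite local_permV groupV.
  apply: sub_finite_set (finite_image g gF) => v /=.
  rewrite local_permV groupV => gv; exists (g^-1%g v) => //.
  exact: aut_Kinv.
have GFFM g h : g \in GFF_pred -> h \in GFF_pred -> (g * h)%g \in GFF_pred.
  move=> /asboolP[gF' gF] /asboolP[hF' hF]; apply/asboolP; split=> [v|].
    by rewrite local_permM groupM.
  have gF2 := finite_image (h^-1%g : tree_aut T) gF.
  apply: (@sub_finite_set _ _
    ([set v | local_perm h v \notin F] `|`
     [set (h^-1)%g v | v in [set v | local_perm g v \notin F]])); last first.
    by rewrite finite_setU.
  move=> v /=; rewrite local_permM => ghv.
  have [hv|hv] := boolP (local_perm h v \in F); last by left.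
  right; exists (h v); last exact: aut_invK.
  by apply: contra ghv => gv; rewrite groupM.
by split=> // g h gG hG; apply: GFFM => //; apply: GFFV.
Qed.

(* The group G(F, F'). *)
Record GFF := MkGFF { gff_aut :> tree_aut T ; _ : gff_aut \in GFF_pred }.

HB.instance Definition _ := [isSub for gff_aut].
HB.instance Definition _ := [Choice of GFF by <:].
HB.instance Definition _ :=
  SubChoice_isSubGroup.Build (tree_aut T) GFF_pred GFF GFF_group_closed.

Definition germ_stabilizer (xi : tree_end T) : set GFF :=
  [set g | \forall eta \near xi, end_map g eta = eta].

End almost_prescribed_local_action.

Definition acts_freely (Omega : finType) (F : {set {perm Omega}}) : Prop :=
  forall s a, s \in F -> s a = a -> s = 1%g.

(* The library equips only pointed types with a sigma-algebra, so nonempty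
   topological spaces are taken in [ptopologicalType]. The base point plays no
   role: maps are not required to preserve it. *)

Section probability_measures.
Variables (R : realType) (X : ptopologicalType).

Definition Prob : Type := probability (g_sigma_algebraType (@open X)) R.

HB.instance Definition _ := Choice.on Prob.

(* The weak-* topology is the coarsest one for which
   mu |-> \int f dmu is continuous for every continuous f : X -> R. *)
Definition weak_star_subbase : set (set Prob) :=
  [set V | exists (f : X -> R) (U : set R),
     [/\ continuous f, open U & V = [set mu : Prob | U (\int[mu]_x f x)%R]]].

HB.instance Definition _ :=
  @isSubBaseTopological.Build Prob (set Prob) weak_star_subbase id.

(* On a compact Hausdorff space, probability measures are understood to be the
   regular Borel ones. *)
Definition regular_measure (mu : Prob) : Prop :=
  forall A : set (g_sigma_algebraType (@open X)), measurable A ->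
    mu A = ereal_inf [set mu U | U in [set U | open (U : set X) /\ A `<=` U]] /\
    mu A = ereal_sup [set mu K | K in [set K | compact (K : set X) /\ K `<=` A]].

Definition dirac_prob (x : X) : Prob :=
  dirac (x : g_sigma_algebraType (@open X)).

End probability_measures.

Section actions.
Variables (G : groupType) (X : ptopologicalType) (act : G -> X -> X).

Definition action_by_homeos : Prop :=
  [/\ forall x, act 1%g x = x,
      forall g h x, act (g * h)%g x = act g (act h x)
    & forall g, continuous (act g)].

Definition minimal_action : Prop :=
  forall x, dense (range (fun g => act g x)).

Definition measure_orbit (R : realType) (mu : Prob R X) : set (Prob R X) :=
  [set nu | exists g, forall A : set (g_sigma_algebraType (@open X)),
     measurable A -> nu A = mu (act g @^-1` A)].

Definition strongly_proximal (R : realType) : Prop :=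
  forall mu : Prob R X, regular_measure mu ->
    exists x : X, closure (measure_orbit mu) (dirac_prob R x).

Definition boundary_action (R : realType) : Prop :=
  [/\ compact [set: X], hausdorff_space X, action_by_homeos, minimal_action
    & strongly_proximal R].

Definition point_stabilizer (x : X) : set G := [set g | act g x = x].

End actions.

Definition furstenberg_boundary (R : realType) (G : groupType)
    (B : ptopologicalType) (act : G -> B -> B) : Prop :=
  boundary_action act R /\
  forall (X : ptopologicalType) (actX : G -> X -> X),
    boundary_action actX R ->
    exists f : B -> X,
      [/\ continuous f, set_surj [set: B] [set: X] f
        & forall g b, f (act g b) = actX g (f b)].

(* Main.v *)
Require Import Defs.
From HB Require Import structures.
From mathcomp Require Import all_boot all_order all_algebra all_fingroup.
From mathcomp Require Import all_classical all_reals all_analysis.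
From mathcomp Require Import finmap measurable_realfun zify ring lra.

(** Write [G] for [G(F, F')] and [xi] for an end of the tree [T].

    Two facts about trees give the combinatorial half of the theorem.  If an
    element of [G] is elliptic and fixes an end, then it fixes a ray towards that
    end pointwise, since a translation along the ray would change the distances
    from its far vertices to the fixed vertex or edge.  Beyond the finitely many
    singularities of the element, each local permutation lies in [F] and fixes the
    colour of an edge of the ray, so it is trivial because [F] acts freely; hence
    the element fixes a whole half-tree containing the end
    ([fixes_tail_ahead]).  Conversely, an element whose germ at [xi] is trivial
    cannot translate along a ray, so it fixes such a half-tree as well
    ([germ_fixes_tail]).  Thus everything reduces to the claim [fixes_over]: if a
    point [b] of the Furstenberg boundary lies over [xi], then an element of [G]
    fixes [b] if and only if it fixes pointwise a half-tree that contains [xi].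

    To speak of points over ends one needs a map from the Furstenberg boundary
    to the ends, but the boundary of [T] itself is too small: a hyperbolic element
    fixes two ends.  It is replaced by a space in which hyperbolic elements act
    freely, the Stone space of the regular open sets of ends, here presented with
    sets of vertices: the points are the ultrafilters in the algebra of
    [decided] sets modulo [null] sets.  Each nonempty open set of this space
    contains all points over some half-tree, and colour-preserving
    automorphisms push the complement of any half-tree into any other half-tree,
    so the action is extremely proximal and therefore a boundary action
    ([compressible_boundary], [cover_boundary]).  The universal property provides
    an equivariant map [rho] from the Furstenberg boundary onto this space.  A
    hyperbolic element sends some decided set to its complement near an end that it
    fixes, so it has no fixed point there ([shift_no_fixpoint]).  This proves one half of the
    claim: a stabilizer consists of elliptic elements that fix the end below.

    For the other half, let [g] fix a half-tree pointwise ([half_tree_fixes_fibre]).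
    The elements of [G] that fix pointwise some half-tree around a given end form
    a locally finite group ([tail_fixator_locally_finite]): finitely many of them
    have their singularities in one ball and are determined by what they do in
    it.  A limit of averages over finite subgroups is a finitely additive
    invariant probability on the fibre over that end ([invariant_content]), and it
    regularises to a Borel probability [mu] ([regular_measure_exists]).  If [g]
    moved a point over its half-tree, it would move a neighbourhood of this point
    off itself, and by strong proximality some translate of [mu] would give this
    neighbourhood more than half of the mass.  The translate sits over an end of
    the half-tree, so it is invariant under [g], and the disjoint image of the
    neighbourhood has more than half of the mass too: a contradiction. *)

Set Implicit Arguments.
Unset Strict Implicit.
Unset Printing Implicit Defensive.

Import Order.TTheory GRing.Theory Num.Theory numFieldNormedType.Exports.

Local Open Scope classical_set_scope.

(** * Distances in trees *)

Section tree_distance.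
Variable T : tree.
Implicit Types (u v w x y a b : T) (p : seq T).

Lemma walk_exists x y :
  exists n, `[< exists p, [/\ path (@adj T) x p, last x p = y & size p = n] >].
Proof. by have [p px pl] := tree_connected x y; exists (size p); apply/asboolP; exists p. Qed.

Definition dist x y : nat := ex_minn (walk_exists x y).

Lemma distP x y : exists p, [/\ path (@adj T) x p, last x p = y & size p = dist x y].
Proof. by rewrite /dist; case: ex_minnP => n /asboolP. Qed.

Lemma dist_le_size x p : path (@adj T) x p -> (dist x (last x p) <= size p)%N.
Proof.
rewrite /dist; case: ex_minnP => n _ + px; apply.
by apply/asboolP; exists p.
Qed.

Lemma distxx x : dist x x = 0%N.
Proof. by have := @dist_le_size x [::] isT; rewrite leqn0 => /eqP. Qed.

Lemma dist_eq0 x y : dist x y = 0%N -> x = y.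
Proof. by move=> d0; have [[|z p] [_ /= xy ps]] := distP x y; rewrite d0 in ps. Qed.

Lemma dist_triangle x y z : (dist x z <= dist x y + dist y z)%N.
Proof.
have [p [px py <-]] := distP x y; have [q [qy qz <-]] := distP y z.
rewrite -qz -py -last_cat -size_cat; apply: dist_le_size.
by rewrite cat_path px py.
Qed.

Lemma dist_sym x y : dist x y = dist y x.
Proof.
suff le u v : (dist v u <= dist u v)%N by apply/eqP; rewrite eqn_leq !le.
have [p [pu pv <-]] := distP u v.
have e : last v (rev (belast u p)) = u.
  by rewrite -pv; case: p {pu pv} => //= z p; rewrite rev_cons last_rcons.
rewrite -[X in dist v X]e -(size_belast u) -size_rev; apply: dist_le_size.
rewrite -pv rev_path (eq_path (e' := @adj T)) // => s t; exact: adj_sym.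
Qed.

Lemma dist_adj x y : adj x y -> dist x y = 1%N.
Proof.
move=> xy; have : (dist x y <= 1)%N by apply: (@dist_le_size x [:: y]); rewrite /= xy.
case E: (dist x y) => [|[|//]] // _.
by move/dist_eq0: E xy => ->; rewrite adj_irr.
Qed.

Lemma closer_exists v x : v != x ->
  exists2 x', adj x x' & dist v x = (dist v x').+1.
Proof.
move=> vx; have [[|x' p] [/= px pl E]] := distP x v.
  by rewrite pl eqxx in vx.
case/andP: px => xx' px; exists x' => //.
have := dist_le_size px; rewrite pl.
have := dist_triangle x x' v; rewrite (dist_adj xx') dist_sym in E *.
rewrite (dist_sym x') ; lia.
Qed.

(** In a cycle-free graph, deleting [x] separates its neighbours: a simple path
    between two of them would close up to a cycle through [x]. *)
Lemma nbr_separated x a p :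
  adj x a -> path (@adj T) a p -> adj x (last a p) -> x \notin a :: p ->
  last a p = a.
Proof.
move=> xa ap; case/shortenP: ap => q aq uq sq xl xp.
have : (size (x :: a :: q) < 3)%N.
  apply: tree_acyclic.
    rewrite cons_uniq uq andbT; apply: contra xp; rewrite !inE.
    by case/orP => [->//|/sq ->]; rewrite orbT.
  by rewrite /= xa rcons_path aq adj_sym.
by case: q {aq uq sq xl} => //=.
Qed.

Lemma geodesic_near x v : exists p, [/\ path (@adj T) x p, last x p = v &
  forall z, z \in p -> (dist v z < dist v x)%N].
Proof.
have [p [px pv ps]] := distP x v; exists p; split=> // z zp.
case/splitPr: zp px pv ps => p1 p2; rewrite cat_path /= => /and3P[_ _ p2z].
rewrite last_cat /= size_cat /= => pv.
have := dist_le_size p2z; rewrite pv dist_sym (dist_sym v x) => h <-; lia.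
Qed.

(** The union of geodesics from [a] and [b] to [v] does not pass through [x]. *)
Lemma closer_unique v x a b : adj x a -> adj x b ->
  dist v x = (dist v a).+1 -> dist v x = (dist v b).+1 -> a = b.
Proof.
move=> xa xb da db.
have [p [pa pv ap]] := geodesic_near a v; have [q [qb qv bq]] := geodesic_near b v.
have nx z : (dist v z < dist v x)%N -> x != z by apply: contraTneq => <-; rewrite ltnn.
have e : last a (p ++ rev (belast b q)) = b.
  rewrite last_cat pv; case: (q) qv => [<-//|z q' _] /=.
  by rewrite rev_cons last_rcons.
have:= @nbr_separated x a (p ++ rev (belast b q)) xa.
rewrite e => -> //.
- rewrite cat_path pa pv /= -qv rev_path (eq_path (e' := @adj T)) // => s t.
  exact: adj_sym.
- rewrite inE mem_cat mem_rev !negb_or nx ?da //=; apply/andP; split.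
    by apply/negP => /ap; rewrite da; lia.
  apply/negP => /mem_belast; rewrite inE => /orP[/eqP xb'|/bq].
    by move: xb; rewrite xb' adj_irr.
  by rewrite db; lia.
Qed.

(** Geodesics from [x] and [y] to [v] would join two neighbours of [x] without
    passing through [x]: a tree is bipartite. *)
Lemma dist_adj_neq v x y : adj x y -> dist v x <> dist v y.
Proof.
move=> xy d.
have vx : v != x.
  apply/eqP => vx; rewrite -vx distxx in d; have vy := dist_eq0 (esym d).
  by move: xy; rewrite -vx -vy adj_irr.
have [x' xx' dx] := closer_exists vx.
have [p [px pv xp]] := geodesic_near x' v; have [q [qy qv yq]] := geodesic_near y v.
have e : last x' (p ++ rev (belast y q)) = y.
  rewrite last_cat pv; case: (q) qv => [<-//|z q' _] /=.
  by rewrite rev_cons last_rcons.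
have yx' : y = x'.
  have:= @nbr_separated x x' (p ++ rev (belast y q)) xx'.
  rewrite e => -> //.
  - rewrite cat_path px pv /= -qv rev_path (eq_path (e' := @adj T)) // => s t.
    exact: adj_sym.
  - rewrite inE mem_cat mem_rev !negb_or; apply/and3P; split.
    + by apply/eqP => xe; move: dx; rewrite -xe; lia.
    + by apply/negP => /xp; lia.
    + apply/negP => /mem_belast; rewrite inE => /orP[/eqP xe|/yq]; last by lia.
      by move: xy; rewrite xe adj_irr.
by move: dx; rewrite -yx' -d; lia.
Qed.

Lemma dist_adj_cases v x y : adj x y ->
  dist v y = (dist v x).+1 \/ dist v x = (dist v y).+1.
Proof.
move=> xy; have := @dist_adj_neq v _ _ xy.
have := dist_triangle v x y; have := dist_triangle v y x.
by rewrite (dist_sym y) (dist_adj xy); lia.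
Qed.

Lemma geodesic_unique x u a b :
  (dist x a + dist a u = dist x u)%N -> (dist x b + dist b u = dist x u)%N ->
  dist x a = dist x b -> a = b.
Proof.
move En: (dist a u) => n; elim: n a b En => [|n IH] a b En ha hb hab.
  by rewrite (dist_eq0 En); have/dist_eq0-> : dist b u = 0%N by lia.
have step z : dist z u = n.+1 -> (dist x z + n.+1)%N = dist x u ->
    exists z', [/\ adj z z', dist z' u = n & dist x z' = (dist x z).+1].
  move=> dz hz; have uz : u != z by apply/eqP => uz; rewrite uz distxx in dz.
  have [z' zz' dz'] := closer_exists uz; exists z'.
  have := dist_triangle x z' u; rewrite dist_sym dz in dz'.
  have := dist_adj_cases x zz'; rewrite (dist_sym z' u); split=> //; lia.
have [a' [aa' da' xa']] := step a En ha.
have [b' [bb' db' xb']] := step b ltac:(lia) ltac:(lia).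
have eab : a' = b' by apply: IH => //; lia.
by apply: (@closer_unique x a') => //; rewrite 1?adj_sym // eab.
Qed.

Lemma aut_dist (g : tree_aut T) x y : dist (g x) (g y) = dist x y.
Proof.
suff le (h : tree_aut T) u v : (dist (h u) (h v) <= dist u v)%N.
  apply/eqP; rewrite eqn_leq le /=.
  by have := le (aut_inv g) (g x) (g y); rewrite /= !aut_invK.
have [p [pu <- <-]] := distP u v.
rewrite -last_map -(size_map h); apply: dist_le_size.
by rewrite path_map (eq_path (e' := @adj T)) // => s t; rewrite /= aut_adj.
Qed.

End tree_distance.

(** * Half-trees *)

Section half_trees.
Variable T : tree.
Implicit Types (u v w x y a b : T).

(** All later arguments about half-trees use this description by distances
    instead of paths. *)
Lemma half_treeE x y : adj x y -> half_tree x y = [set v | (dist v y < dist v x)%N].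
Proof.
move=> xy; apply/seteqP; split=> v /=.
  suff side u p : (dist u y < dist u x)%N ->
      path [rel a b | adj a b && ([set a; b] != [set x; y])] u p ->
      (dist (last u p) y < dist (last u p) x)%N.
    by case=> p py <-; apply: side py; rewrite distxx dist_sym (dist_adj xy).
  elim: p u => [//|w p IH] u ud /= /andP[/andP[uw ne] pw]; apply: IH pw.
  (* Otherwise [u] and [w] would be opposite corners of a square with [x, y]. *)
  have := dist_adj_cases w xy; have := dist_adj_cases x uw.
  have := dist_adj_cases y uw; have := dist_adj_cases u xy.
  rewrite !(dist_sym _ x) !(dist_sym _ y) in ud * => h1 h2 h3 [h4|//]; last by lia.
  have [yu|yu] := eqVneq y u.
    have xw : x = w by apply: dist_eq0; move: ud h1 h2 h3 h4; rewrite -yu distxx; lia.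
    by move: ne; rewrite -yu -xw setUC eqxx.
  have [u' uu' du'] := closer_exists yu.
  have uw' : u' = w.
    apply: (@closer_unique _ x u) => //; last by lia.
    have := dist_triangle x y u'; rewrite (dist_adj xy).
    have := dist_adj_cases x uu'; lia.
  by rewrite uw' in du'; lia.
move En: (dist v y) => n; elim: n v En => [|n IH] v En vd.
  by exists [::] => //=; rewrite (dist_eq0 En).
have yv : y != v by apply/eqP => yv; rewrite yv distxx in En.
have [v' vv' dv'] := closer_exists yv.
rewrite dist_sym En in dv'.
have [p py pl] : half_tree x y v'.
  apply: IH; first by rewrite dist_sym; lia.
  have := dist_triangle v v' x; rewrite (dist_adj vv'); lia.
exists (rcons p v); last by rewrite last_rcons.
rewrite rcons_path py pl /= adj_sym vv' /=; apply/eqP => e.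
have vx : v != x by apply/eqP => vx; rewrite vx distxx in vd.
have : [set v'; v] v by right.
rewrite e => -[|] /= ve; first by rewrite ve eqxx in vx.
by rewrite ve eqxx in yv.
Qed.

Lemma half_treeP x y v : adj x y ->
  half_tree x y v <-> (dist v y < dist v x)%N.
Proof. by move=> xy; rewrite half_treeE. Qed.

Lemma half_treeC x y : adj x y -> ~` half_tree x y = half_tree y x.
Proof.
move=> xy; rewrite !half_treeE // 1?adj_sym//; apply/seteqP; split=> v /=.
  by move=> /negP; have := dist_adj_cases v xy; lia.
by move=> h; apply/negP; lia.
Qed.

Lemma half_tree_tip x y : adj x y -> half_tree x y y.
Proof. by move=> xy; apply/half_treeP => //; rewrite distxx dist_sym dist_adj. Qed.

Lemma half_tree_root x y : adj x y -> ~ half_tree x y x.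
Proof. by move=> xy /half_treeP; rewrite distxx (dist_adj xy) => /(_ xy). Qed.

(** A geodesic between the two sides of an edge runs through that edge. *)
Lemma dist_across a b v x : adj a b -> half_tree a b v -> half_tree b a x ->
  dist v x = (dist v b + (dist a x).+1)%N.
Proof.
move=> ab /half_treeP va /half_treeP xb.
have {}va := va ab; have {}xb: (dist x a < dist x b)%N by apply: xb; rewrite adj_sym.
have da : dist v a = (dist v b).+1 by have := dist_adj_cases v ab; lia.
move: {2}(dist a x) (erefl (dist a x)) => n.
elim/ltn_ind: n x xb => n IH x xb En.
have [ax|ax] := eqVneq a x; first by rewrite -ax distxx addn1.
have [y xy dy] := closer_exists ax.
have yb : (dist y a < dist y b)%N.
  have := dist_triangle x y b; rewrite (dist_adj xy) (dist_sym y a); rewrite (dist_sym x a) in xb; lia.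
have Ey := IH (dist a y) ltac:(lia) y yb erefl.
rewrite dy; case: (dist_adj_cases v xy) => [e|]; last by lia.
have [ay|ay] := eqVneq a y.
  have xeb : x = b.
    by apply: (@closer_unique _ v a) => //; rewrite ?ay 1?adj_sym // -?ay da.
  by move: xb; rewrite xeb distxx dist_sym (dist_adj ab).
have [z yz dz] := closer_exists ay.
have zb : (dist z a < dist z b)%N.
  have := dist_triangle y z b; rewrite (dist_adj yz) (dist_sym z a); rewrite (dist_sym y a) in yb; lia.
have Ez := IH (dist a z) ltac:(lia) z zb erefl.
have xz : x = z by apply: (@closer_unique _ v y) => //; rewrite 1?adj_sym //; lia.
by rewrite xz in dy; lia.
Qed.

(** By [dist_across], the difference of the distances to [x] and to [y] is the
    same for all vertices beyond the edge. *)
Lemma half_tree_side a b x y : adj a b -> adj x y ->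
  ~ half_tree a b x -> ~ half_tree a b y ->
  half_tree a b `<=` half_tree x y \/ half_tree a b `<=` half_tree y x.
Proof.
move=> ab xy; rewrite -[~ _ x]/((~` half_tree a b) x) -[~ _ y]/((~` half_tree a b) y).
rewrite half_treeC // => hx hy; have yx : adj y x by rewrite adj_sym.
have dx v hv := @dist_across a b v x ab hv hx.
have dy v hv := @dist_across a b v y ab hv hy.
case: (dist_adj_cases a xy) => e; [right|left] => v hv; apply/half_treeP => //;
  by rewrite (dx _ hv) (dy _ hv); lia.
Qed.

Lemma half_tree_sub x y v z : adj x y -> half_tree x y v -> adj v z ->
  dist x z = (dist x v).+1 -> half_tree v z `<=` half_tree x y.
Proof.
move=> xy vxy vz dz u uz; apply/half_treeP => //.
have zv : adj z v by rewrite adj_sym.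
have dv : dist v x = (dist v y).+1.
  by have := dist_adj_cases v xy; move/half_treeP: vxy => /(_ xy); lia.
have hx : half_tree z v x by apply/half_treeP => //; lia.
have hy : half_tree z v y.
  apply/half_treeP => //; have := dist_triangle z y x.
  rewrite (dist_sym y x) (dist_adj xy) (dist_sym z x) (dist_sym y z) (dist_sym y v).
  have := dist_sym x v; lia.
by rewrite (dist_across vz uz hx) (dist_across vz uz hy); lia.
Qed.

Lemma half_tree_disjoint v a b : adj v a -> adj v b -> a <> b ->
  half_tree v a `&` half_tree v b = set0.
Proof.
move=> va vb ab; rewrite !half_treeE // -subset0 => u [/= ua ub]; apply: ab.
by apply: (@closer_unique _ u v) => //; [have := dist_adj_cases u va|have := dist_adj_cases u vb]; lia.
Qed.

Lemma aut_half_tree (g : tree_aut T) x y : adj x y ->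
  g @` half_tree x y = half_tree (g x) (g y).
Proof.
move=> xy; have gxy : adj (g x) (g y) by rewrite aut_adj.
rewrite !half_treeE //; apply/seteqP; split=> [_ [v /= h <-]|v /= h].
  by rewrite /= !aut_dist.
exists (aut_inv g v); last exact: aut_Kinv.
by rewrite -(aut_dist g _ x) -(aut_dist g _ y) aut_Kinv.
Qed.

Lemma aut_preimage_half_tree (g : tree_aut T) x y : adj x y ->
  g @^-1` half_tree (g x) (g y) = half_tree x y.
Proof.
move=> xy; have gxy : adj (g x) (g y) by rewrite aut_adj.
by rewrite !half_treeE //; apply/seteqP; split=> v /=; rewrite !aut_dist.
Qed.

End half_trees.

(** * Rays and ends *)

Section rays.
Variable T : tree.
Implicit Types (u v w x y a b : T) (r s : nat -> T).

Definition ahead r n : set T := half_tree (r n) (r n.+1).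

Lemma ray_adj r n : ray r -> adj (r n) (r n.+1).
Proof. by case. Qed.

Lemma ray_neq r m n : ray r -> m <> n -> r m <> r n.
Proof. by case=> rinj _ mn /rinj. Qed.

(** A walk that never turns back cannot come nearer to [v] once it has moved
    away from it, since each vertex has one neighbour nearer to [v]. *)
Lemma away_from r v n : (forall k, adj (r k) (r k.+1)) ->
  (forall k, r k <> r k.+2) ->
  dist v (r n.+1) = (dist v (r n)).+1 ->
  forall k, dist v (r (n + k)%N) = (dist v (r n) + k)%N.
Proof.
move=> radj rne dn k.
suff : dist v (r (n + k)%N) = (dist v (r n) + k)%N /\
       dist v (r (n + k).+1) = (dist v (r n) + k).+1 by case.
elim: k => [|k [h1 h2]]; first by rewrite !addn0.
rewrite !addnS; split=> //.
case: (dist_adj_cases v (radj (n + k).+1)) => [->|e]; first by rewrite h2.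
case: (@rne (n + k)%N); apply: (@closer_unique _ v (r (n + k).+1)) => //.
  by rewrite adj_sym.
by rewrite h1 h2.
Qed.

Lemma nonbacktracking_ray r : (forall k, adj (r k) (r k.+1)) ->
  (forall k, r k <> r k.+2) -> ray r.
Proof.
move=> radj rne; split=> // i j.
wlog ij : i j / (i <= j)%N => [wl|] rij.
  by case/orP: (leq_total i j) => /wl h; [|apply/esym]; apply: h.
have d1 : dist (r i) (r i.+1) = (dist (r i) (r i)).+1 by rewrite distxx dist_adj.
by have := away_from radj rne d1 (j - i)%N; rewrite subnKC // -rij distxx; lia.
Qed.

Lemma ray_away r v n : ray r -> dist v (r n.+1) = (dist v (r n)).+1 ->
  forall k, dist v (r (n + k)%N) = (dist v (r n) + k)%N.
Proof. by move=> rr; apply: away_from => k; [case: rr|apply: ray_neq => //; lia]. Qed.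

Lemma ray_dist r n k : ray r -> dist (r n) (r (n + k)%N) = k.
Proof.
move=> rr; rewrite (@ray_away r (r n) n rr) ?distxx //.
by rewrite dist_adj //; apply: ray_adj.
Qed.

Lemma ray_eventually_away r v : ray r ->
  exists N, forall k, dist v (r (N + k)%N) = (dist v (r N) + k)%N.
Proof.
move=> rr.
suff [N dN] : exists N, dist v (r N.+1) = (dist v (r N)).+1.
  by exists N; apply: ray_away.
apply: contrapT => nN.
have dec n : (dist v (r n) + n <= dist v (r 0))%N.
  elim: n => [|n IH]; first by rewrite addn0.
  have : ~ dist v (r n.+1) = (dist v (r n)).+1 by move=> e; apply: nN; exists n.
  by case: (dist_adj_cases v (ray_adj n rr)) => //; lia.
by have := dec (dist v (r 0)).+1; lia.
Qed.

Lemma aheadP r n v : ray r -> ahead r n v <-> (dist v (r n.+1) < dist v (r n))%N.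
Proof. by move=> rr; apply: half_treeP; apply: ray_adj. Qed.

Lemma ahead_decr r m n : ray r -> (m <= n)%N -> ahead r n `<=` ahead r m.
Proof.
move=> rr /subnKC <-; elim: (n - m)%N => [|k IH]; first by rewrite addn0.
rewrite addnS; apply: subset_trans IH => v /(aheadP _ _ rr) dv; apply/(aheadP _ _ rr).
case: (dist_adj_cases v (ray_adj (m + k) rr)); last by lia.
by move=> /(ray_away rr) d; have := d 1%N; have := d 2; rewrite addn1 addn2; lia.
Qed.

Lemma ahead_rayP r n k : ray r -> ahead r n (r k) <-> (n < k)%N.
Proof.
move=> rr; rewrite aheadP //; have [nk|kn] := ltnP n k.
  rewrite (dist_sym _ (r n)) (dist_sym _ (r n.+1)) -(subnKC nk) ray_dist //.
  by rewrite addSnnS ray_dist //; split=> //; lia.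
by rewrite -(subnKC kn) ray_dist // -addnS ray_dist //; split=> //; lia.
Qed.

Lemma ahead_escape r v : ray r -> exists N, forall n, (N <= n)%N -> ~ ahead r n v.
Proof.
move=> rr; have [N dN] := ray_eventually_away v rr; exists N => n /subnKC <-.
by rewrite aheadP // -addnS !dN; lia.
Qed.

Lemma ahead_side r x y : ray r -> adj x y ->
  exists N, ahead r N `<=` half_tree x y \/ ahead r N `<=` half_tree y x.
Proof.
move=> rr xy; have [M hM] := ahead_escape x rr; have [N hN] := ahead_escape y rr.
exists (maxn M N); apply: half_tree_side => //; first exact: ray_adj.
  by apply: hM; lia.
by apply: hN; lia.
Qed.

(** Both rays run along the geodesic from [r 0] to a point far ahead on both of
    them, where positions are determined by the distance to [r 0]. *)
Lemma rays_cofinal r s : ray r -> ray s ->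
  (forall n m, ahead r n `&` ahead s m !=set0) -> cofinal_rays r s.
Proof.
move=> rr rs meet; have [N dN] := ray_eventually_away (r 0) rs.
exists (dist (r 0) (s N)), N => k; set j := (_ + k)%N.
have [u [ur us]] := meet j (N + k)%N.
have r0 : half_tree (r j.+1) (r j) (r 0).
  by rewrite -half_treeC; [rewrite /= -/(ahead r j) ahead_rayP|exact: ray_adj].
have s0 : half_tree (s (N + k).+1) (s (N + k)%N) (r 0).
  rewrite -half_treeC; last exact: ray_adj.
  by rewrite /= -/(ahead s _) aheadP // -addnS !dN; lia.
have d0 := dist_sym (r 0) u.
have := dist_across (ray_adj j rr) ur r0; have := dist_across (ray_adj (N + k) rs) us s0.
have := ray_dist 0 j rr; rewrite add0n.
have := (aheadP _ _ rr).1 ur; have := (aheadP _ _ rs).1 us.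
have := dist_adj_cases u (ray_adj j rr); have := dist_adj_cases u (ray_adj (N + k) rs).
have := dN k; rewrite -/j (dist_sym _ (r 0)) (dist_sym (s _) (r 0)) => e1 e2 e3 e4 e5 e6 e7 e8.
have := dist_sym (r j) (r 0); have := dist_sym (r j) u.
have := dist_sym (s (N + k)%N) u => f1 f2 f3.
by apply: (@geodesic_unique _ (r 0) u); lia.
Qed.

Lemma cofinal_ahead r s m n k : (forall k, r (m + k)%N = s (n + k)%N) ->
  ahead r (m + k) = ahead s (n + k).
Proof. by move=> rs; rewrite /ahead -!addnS !rs. Qed.

Lemma ray_shift r n : ray r -> ray (fun k => r (n + k)%N).
Proof.
case=> rinj radj; split=> [i j /rinj/addnI //|k].
by rewrite addnS; apply: radj.
Qed.

Lemma aut_ray (g : tree_aut T) r : ray r -> ray (g \o r).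
Proof.
case=> rinj radj; split=> [i j /= /(bij_inj (aut_bij g))/rinj //|k /=].
by rewrite aut_adj.
Qed.

Lemma cofinal_refl r : cofinal_rays r r.
Proof. by exists 0%N, 0%N. Qed.

Lemma cofinal_sym r s : cofinal_rays r s -> cofinal_rays s r.
Proof. by case=> m [n rs]; exists n, m => k; rewrite rs. Qed.

Lemma cofinal_trans r s t : cofinal_rays r s -> cofinal_rays s t -> cofinal_rays r t.
Proof.
case=> m [n rs] [m' [n' st]]; exists (m + m')%N, (n' + n)%N => k.
by rewrite -!addnA rs -st; congr s; lia.
Qed.

End rays.

Section ends.
Variable T : tree.
Implicit Types (x y : T) (r s : nat -> T) (xi eta : tree_end T).

Lemma end_ray xi : exists2 r, ray r & end_rays xi r.
Proof.
have [r rr ->] := end_raysP xi; exists r => //=.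
by split=> //; apply: cofinal_refl.
Qed.

Lemma end_rays_ray xi r : end_rays xi r -> ray r.
Proof. by have [s _ ->] := end_raysP xi => -[]. Qed.

Lemma end_raysE xi r : end_rays xi r -> end_rays xi = [set s | ray s /\ cofinal_rays r s].
Proof.
have [s ss ->] := end_raysP xi => -[rr sr]; apply/seteqP; split=> t /= [tt c]; split=> //.
  exact: cofinal_trans (cofinal_sym sr) c.
exact: cofinal_trans sr c.
Qed.

Lemma end_of_ray_subproof r : ray r ->
  exists2 s, ray s & [set s | ray s /\ cofinal_rays r s] = [set t | ray t /\ cofinal_rays s t].
Proof. by move=> rr; exists r. Qed.

Definition end_of_ray r (rr : ray r) : tree_end T := TreeEnd (end_of_ray_subproof rr).

Lemma end_of_rayP r (rr : ray r) : end_rays (end_of_ray rr) r.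
Proof. by split=> //; apply: cofinal_refl. Qed.

Lemma end_eq xi eta r s : end_rays xi r -> end_rays eta s -> cofinal_rays r s -> xi = eta.
Proof.
move=> xr es rs; apply: tree_endP; rewrite (end_raysE xr) (end_raysE es).
apply/seteqP; split=> t /= [tt c]; split=> //.
  exact: cofinal_trans (cofinal_sym rs) c.
exact: cofinal_trans rs c.
Qed.

Lemma end_map_ray (g : tree_aut T) xi r : end_rays xi r -> end_rays (end_map g xi) (g \o r).
Proof. by move=> xr; exists r. Qed.

Lemma ends_ofP xi r x y : end_rays xi r -> adj x y ->
  ends_of (half_tree x y) xi <-> exists N, ahead r N `<=` half_tree x y.
Proof.
move=> xr xy; have rr := end_rays_ray xr; split=> [[s xs sH]|[N rN]].
  have rs := end_rays_ray xs.
  have [N [sN|sN]] := ahead_side rs xy; last first.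
    have /sN : ahead s N (s N.+1) by apply/ahead_rayP.
    by rewrite -half_treeC //= => -[]; apply: sH.
  move: xs; rewrite (end_raysE xr) => -[_ [m [n c]]].
  exists (m + N)%N; rewrite (cofinal_ahead _ c); apply: subset_trans sN.
  by apply: ahead_decr => //; lia.
exists (fun k => r (N.+1 + k)%N).
  rewrite (end_raysE xr); split; first exact: ray_shift.
  by exists N.+1, 0%N.
by move=> n; apply/rN/ahead_rayP => //; lia.
Qed.

End ends.

(** * Coloured walks and colour-preserving automorphisms *)

Section coloured_walks.
Variables (T : tree) (Omega : finType) (c : colouring T Omega).
Implicit Types (v w x y : T) (a b : Omega) (s : seq Omega).

Lemma nbrK v a : nbr c (nbr c v a) a = v.
Proof.
have vw := nbr_adj c v a.
rewrite -[X in nbr c _ X](colour_nbr c v a) colour_sym // nbr_colour //.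
by rewrite adj_sym.
Qed.

Definition walk v s : T := foldl (nbr c) v s.

Lemma walk_cat v s t : walk v (s ++ t) = walk (walk v s) t.
Proof. exact: foldl_cat. Qed.

Lemma walk_rcons v s a : walk v (rcons s a) = nbr c (walk v s) a.
Proof. by rewrite -cats1 walk_cat. Qed.

Lemma walk_rev v s : walk (walk v s) (rev s) = v.
Proof.
elim: s v => [//|a s IH] v.
by rewrite rev_cons walk_rcons [walk v _]/= -/(walk _ _) IH nbrK.
Qed.

Lemma walk_reach v w : exists2 s, walk v s = w & size s = dist v w.
Proof.
have [p [+ <- <-]] := distP v w; elim: p v => [|x p IH] v /=; first by exists [::].
case/andP => vx /IH[s sp ss]; exists (c v x :: s); last by rewrite /= ss.
by rewrite /= -/(walk _ _) nbr_colour.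
Qed.

(** Consecutive steps of different colours do not turn back, so each step leads
    farther away. *)
Lemma dist_walk_reduced v s a : sorted (fun a b => a != b) (rcons s a) ->
  dist v (walk v s) = size s /\ dist v (walk v (rcons s a)) = (size s).+1.
Proof.
elim/last_ind: s a => [|s a IH] b.
  by move=> _; rewrite distxx dist_adj // nbr_adj.
move=> sb; have [sa ab] : sorted (fun a b => a != b) (rcons s a) /\ a != b.
  move: sb; case: s {IH} => [|d s] /=; first by rewrite andbT.
  by rewrite !rcons_path last_rcons => /andP[].
have [dx dy] := IH _ sa; rewrite size_rcons; split=> //.
set y := walk v (rcons s a) in dy *.
have yz : adj y (walk v (rcons (rcons s a) b)) by rewrite walk_rcons nbr_adj.
case: (dist_adj_cases v yz) => [->|dz]; first by rewrite dy.
have yx : adj y (walk v s) by rewrite /y walk_rcons adj_sym nbr_adj.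
have e : walk v s = walk v (rcons (rcons s a) b).
  by apply: (@closer_unique _ v y) => //; rewrite dx dy.
case/eqP: ab; rewrite -(colour_nbr c y b) -walk_rcons -e /y walk_rcons.
by rewrite -colour_sym ?colour_nbr // nbr_adj.
Qed.

Lemma not_reduced s : ~~ sorted (fun a b => a != b) s ->
  exists s1 a s2, s = s1 ++ a :: a :: s2.
Proof.
case: s => [//|a s] /=; elim: s a => [//|b s IH] a /=; rewrite negb_and negbK.
case/orP => [/eqP <-|/IH[s1 [d [s2 ->]]]]; first by exists [::], a, s.
by exists (a :: s1), d, s2.
Qed.

(** A closed walk in a tree turns back somewhere, and cancelling there two steps
    of equal colour leaves a shorter closed walk: so the word alone decides
    whether the walk is closed. *)
Lemma walk_closed v w s : walk v s = v -> walk w s = w.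
Proof.
move: {2}(size s) (leqnn (size s)) => n; elim: n s => [|n IH] s.
  by rewrite leqn0 size_eq0 => /eqP ->.
move=> sn sv; have [sr|] := boolP (sorted (fun a b => a != b) s).
  case/lastP: s sr sv sn => [//|s a]  sr sv _; have [_] := dist_walk_reduced v sr.
  by rewrite sv distxx.
case/not_reduced => s1 [a [s2 es]].
have sE u : walk u s = walk u (s1 ++ s2) by rewrite es !walk_cat /= nbrK.
rewrite sE; apply: IH; last by rewrite -sE.
by move: sn; rewrite es !size_cat /=; lia.
Qed.

Definition word v x : seq Omega := s2val (cid2 (walk_reach v x)).

Lemma walk_word v x : walk v (word v x) = x.
Proof. exact: (s2valP (cid2 (walk_reach v x))). Qed.

Definition transport_fun v w x : T := walk w (word v x).

Lemma transport_walk v w s : transport_fun v w (walk v s) = walk w s.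
Proof.
have := @walk_closed v w (word v (walk v s) ++ rev s).
rewrite !walk_cat walk_word walk_rev => /(_ erefl) e.
by rewrite /transport_fun -[LHS](walk_rev _ (rev s)) revK e.
Qed.

Lemma transportK v w : cancel (transport_fun v w) (transport_fun w v).
Proof. by move=> x; rewrite {2}/transport_fun transport_walk walk_word. Qed.

Lemma transport_nbr v w x a :
  transport_fun v w (nbr c x a) = nbr c (transport_fun v w x) a.
Proof. by rewrite -{1}(walk_word v x) -walk_rcons transport_walk walk_rcons. Qed.

Lemma transport_adj v w : {mono transport_fun v w : x y / adj x y}.
Proof.
have half v' w' x y : adj x y -> adj (transport_fun v' w' x) (transport_fun v' w' y).
  by move=> xy; rewrite -(nbr_colour c xy) transport_nbr nbr_adj.
by move=> x y; apply/idP/idP => [/(half w v)|/half //]; rewrite !transportK.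
Qed.

(** The colour-preserving automorphism that carries [v] to [w]. *)
Definition transport v w : tree_aut T :=
  TreeAut (Bijective (transportK v w) (transportK w v)) (@transport_adj v w).

Lemma transport_base v w : transport v w v = w.
Proof. exact: (transport_walk v w [::]). Qed.

Lemma local_perm_transport v w x : local_perm c (transport v w) x = 1%g.
Proof. by apply/permP => a; rewrite permE perm1 /= transport_nbr colour_nbr. Qed.

Lemma transport_GFF (F F' : {group {perm Omega}}) v w : transport v w \in GFF_pred c F F'.
Proof.
apply/asboolP; split=> [x|]; first by rewrite local_perm_transport group1.
rewrite (_ : mkset _ = set0) //; apply/seteqP; split=> // x /=.
by rewrite local_perm_transport group1.
Qed.

Lemma other_colour a b d : (3 < #|Omega|)%N -> exists e, [/\ e <> a, e <> b & e <> d].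
Proof.
move=> h; apply: contrapT => ne.
have : (#|Omega| <= #|[:: a; b; d]|)%N.
  apply/subset_leq_card/fintype.subsetP => e _; apply/negPn/negP.
  by rewrite !inE !negb_or => /and3P[/eqP ea /eqP eb /eqP ed]; apply: ne; exists e.
by move=> le; have := leq_trans h (leq_trans le (card_size _)).
Qed.

(** Far enough in the target half-tree there is an edge of the right colour and
    with the right orientation. *)
Lemma half_tree_push (F F' : {group {perm Omega}}) x y x' y' :
  adj x y -> adj x' y' ->
  exists g : GFF c F F', g @` (~` half_tree x y) `<=` half_tree x' y'.
Proof.
move=> xy xy'; rewrite half_treeC //; have yx : adj y x by rewrite adj_sym.
suff [z [xz hz]] : exists z, [/\ adj (nbr c z (c x y)) z &
    half_tree (nbr c z (c x y)) z `<=` half_tree x' y'].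
  exists (MkGFF (transport_GFF F F' x z)).
  rewrite -[_ @` _]/(transport x z @` half_tree y x) aut_half_tree // transport_base.
  suff -> : transport x z y = nbr c z (c x y) by [].
  by rewrite -{1}(nbr_colour c xy) /= transport_nbr (transport_walk x z [::]).
have [e|ne] := eqVneq (c x' y') (c x y).
  have yx' : adj y' x' by rewrite adj_sym.
  by exists y'; rewrite -e colour_sym // nbr_colour //; split.
exists (nbr c y' (c x y)); rewrite nbrK nbr_adj; split=> //.
apply: half_tree_sub => //; [exact: half_tree_tip|exact: nbr_adj|].
case: (dist_adj_cases x' (nbr_adj c y' (c x y))) => // d.
have dx : dist x' y' = (dist x' x').+1 by rewrite distxx dist_adj.
have := closer_unique (nbr_adj c y' (c x y)) _ d dx; rewrite adj_sym => /(_ xy') ez.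
by case/eqP: ne; rewrite -(colour_nbr c y' (c x y)) ez colour_sym.
Qed.

End coloured_walks.

(** * The topology on the space of ends *)

Section subbases.
Variables (T : Type) (I : pointedType) (D : set I) (b : I -> set T).

(** The hypothesis on [W] is what the topology generated by the subbase [b]
    unfolds to; it is spelt out so that the lemma applies to every type whose
    topology is given in this way. *)
Lemma subbase_nbhs (W : set T) x :
  (exists2 D' : set (set T), D' `<=` finI_from D b & \bigcup_(A in D') A = W) ->
  W x -> forall Phi : set (set T), Filter Phi ->
  (forall i, D i -> b i x -> Phi (b i)) -> Phi W.
Proof.
case=> D' D'b <- [A DA Ax] Phi FPhi sub.
apply: (@filterS _ Phi _ A); first by move=> y Ay; exists A.
have [E ED eA] := D'b _ DA; rewrite -eA.
apply: filter_bigI => i iE; apply: sub; first by have /set_mem := ED _ iE.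
by move: Ax; rewrite -eA; apply.
Qed.

Lemma subbase_open i : D i ->
  exists2 D' : set (set T), D' `<=` finI_from D b & \bigcup_(A in D') A = b i.
Proof.
move=> Di; exists [set b i]; last by rewrite bigcup_set1.
move=> _ ->; exists [fset i]%fset; first by move=> j /fset1P ->; apply: mem_set.
by apply/seteqP; split=> y /=; [apply; rewrite /= inE|move=> by_ j /= /fset1P ->].
Qed.

End subbases.

Section ends_topology.
Variable T : tree.
Implicit Types (x y : T) (r s : nat -> T) (xi eta : tree_end T).

Lemma open_ends_of x y : adj x y -> open (ends_of (half_tree x y)).
Proof. by move=> xy; apply: (@subbase_open _ _ (@is_half_tree T)); exists x, y. Qed.

Lemma nbhs_endP xi r (P : set (tree_end T)) : end_rays xi r ->
  nbhs xi P -> exists N, ends_of (ahead r N) `<=` P.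
Proof.
move=> xr; have rr := end_rays_ray xr; rewrite nbhsE => -[W [oW Wxi] WP].
suff [N hN] : exists N, ends_of (ahead r N) `<=` W by exists N; apply: subset_trans WP.
pose Phi := [set Q : set (tree_end T) | exists N, ends_of (ahead r N) `<=` Q].
have FPhi : Filter Phi.
  split; first by exists 0%N.
  - move=> P1 P2 [N1 h1] [N2 h2]; exists (maxn N1 N2) => eta [s es sa].
    split; [apply: h1|apply: h2]; exists s => // n; move: (sa n); apply: ahead_decr => //; lia.
  - by move=> P1 P2 sub [N h]; exists N; apply: subset_trans sub.
apply: (subbase_nbhs oW Wxi FPhi) => _ [x [y [xy ->]]] /(ends_ofP xr xy)[N hN].
by exists N => eta [s es sa]; exists s => // n; apply: hN.
Qed.

End ends_topology.

(** * Automorphisms that fix an end *)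

Section fixed_ends.
Variable T : tree.
Implicit Types (u v w x y a b : T) (r s : nat -> T) (xi eta : tree_end T).
Implicit Type g : tree_aut T.

Definition fixes_on g (A : set T) := forall v, A v -> g v = v.

Lemma half_tree_parent a b u : adj a b -> half_tree a b u ->
  exists w, [/\ adj u w, dist a u = (dist a w).+1 & half_tree a b w \/ w = a].
Proof.
move=> ab hu; have au : a != u.
  by apply/eqP => au; rewrite -au in hu; exact: half_tree_root hu.
have [w uw dw] := closer_exists au; exists w; split=> //.
have [hw|nw] := pselect (half_tree a b w); [by left|right; move: nw].
rewrite -[~ _]/((~` half_tree a b) w) half_treeC // => hw.
have := dist_across ab hu hw; rewrite dist_adj // => d.
by apply/esym/dist_eq0; lia.
Qed.

Lemma fixes_end g xi r : end_rays xi r -> end_map g xi = xi -> cofinal_rays (g \o r) r.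
Proof.
move=> xr gx; have := end_map_ray g xr; rewrite gx (end_raysE xr).
by case=> _; apply: cofinal_sym.
Qed.

Lemma cofinal_fixes_end g xi r : end_rays xi r -> cofinal_rays (g \o r) r -> end_map g xi = xi.
Proof. by move=> xr; apply: end_eq (end_map_ray g xr) xr. Qed.

(** Translating along a ray changes the distance from far points of the ray to
    any fixed vertex or edge, which an elliptic automorphism must preserve. *)
Lemma elliptic_fixes_tail g r : elliptic g -> ray r -> cofinal_rays (g \o r) r ->
  exists M, forall k, (M <= k)%N -> g (r k) = r k.
Proof.
move=> ell rr [m [n gr]].
have shift v w : exists N, forall k, (N <= k)%N ->
    dist v (r k) = (dist v (r N) + (k - N))%N /\ dist w (r k) = (dist w (r N) + (k - N))%N.
  have [N1 d1] := ray_eventually_away v rr; have [N2 d2] := ray_eventually_away w rr.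
  exists (N1 + N2)%N => k kN.
  have := d1 N2; have := d1 (k - N1)%N; have := d2 N1; have := d2 (k - N2)%N.
  rewrite (addnC N2 N1) !subnKC; lia.
suff mn : m = n.
  exists m => k /subnKC <-; exact: eq_trans (gr _) (congr1 (fun n => r (n + _)%N) (esym mn)).
case: ell => [[v gv]|[v [w [vw evw]]]].
  have [N dN] := shift v v.
  have := aut_dist g v (r (m + N)%N); rewrite gv [g (r _)]gr.
  have [-> _] := dN (m + N)%N ltac:(lia); have [-> _] := dN (n + N)%N ltac:(lia); lia.
have [N dN] := shift v w.
have [] : (g v = v \/ g v = w) /\ (g w = v \/ g w = w).
  have in2 u : [set v; w] u -> g u = v \/ g u = w.
    by move=> hu; have : [set v; w] (g u) by rewrite -evw; exists u.
  by split; apply: in2; [left|right].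
have := aut_dist g v (r (m + N)%N); have := aut_dist g w (r (m + N)%N).
rewrite [g (r _)]gr.
have [-> ->] := dN (m + N)%N ltac:(lia); have [e1 e2] := dN (n + N)%N ltac:(lia).
by move=> h1 h2 [g1|g1] [g2|g2]; rewrite g1 in h2; rewrite g2 in h1; lia.
Qed.

End fixed_ends.

Section prescribed_local_action.
Variables (T : tree) (Omega : finType) (c : colouring T Omega).
Variables (F F' : {group {perm Omega}}).
Hypothesis Ffree : acts_freely F.
Implicit Types (u v w x y : T) (r s : nat -> T) (xi eta : tree_end T).

Lemma aut_nbr (g : tree_aut T) v a : g (nbr c v a) = nbr c (g v) (local_perm c g v a).
Proof. by rewrite permE nbr_colour // aut_adj nbr_adj. Qed.

(** In a group that acts freely a permutation is determined by the image of one
    point, here the colour of the edge from [v] to [w]. *)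
Lemma same_local_perm (g h : tree_aut T) v w : adj v w ->
  local_perm c g v \in F -> local_perm c h v \in F ->
  g v = h v -> g w = h w -> local_perm c g v = local_perm c h v.
Proof.
move=> vw gF hF ev ew.
have ea : local_perm c g v (c v w) = local_perm c h v (c v w).
  by rewrite !permE nbr_colour // ev ew.
apply/eqP; rewrite eq_mulgV1; apply/eqP.
by apply: (Ffree (a := c v w)); rewrite ?groupM ?groupV // permM ea permK.
Qed.

Lemma fixes_nbrs (g : tree_aut T) v w : local_perm c g v \in F ->
  g v = v -> adj v w -> g w = w -> forall x, adj v x -> g x = x.
Proof.
move=> gF gv vw gw x vx; rewrite -(nbr_colour c vx) aut_nbr gv.
rewrite (@same_local_perm g 1%g v w) // ?local_perm1 ?perm1 //.
Qed.

Lemma singular_escape (g : GFF c F F') r : ray r ->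
  exists N, forall n v, (N <= n)%N -> ahead r n v -> local_perm c g v \in F.
Proof.
move=> rr; case: g => g /= /asboolP[_ /finite_seqP[S eS]].
suff [N hN] : exists N, forall n v, (N <= n)%N -> v \in S -> ~ ahead r n v.
  exists N => n v /hN hn vn; apply/negPn/negP => gv.
  by have /hn : v \in S by have : [set v | local_perm c g v \notin F] v by []; rewrite eS.
elim: S {eS} => [|x S [N hN]]; first by exists 0%N.
have [M hM] := ahead_escape x rr; exists (maxn M N) => n v nMN.
rewrite inE => /orP[/eqP ->|vS]; [apply: hM|apply: hN] => //; lia.
Qed.

(** Beyond the finitely many singularities, a local permutation fixing the edge
    back to the ray is trivial as [F] acts freely, so the fixed part spreads. *)
Lemma fixes_tail_ahead (g : GFF c F F') r M : ray r ->
  (forall k, (M <= k)%N -> g (r k) = r k) -> exists N, fixes_on g (ahead r N).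
Proof.
move=> rr gr; have [N0 hN0] := singular_escape g rr.
pose N := maxn N0 M; exists N => v hv.
have rN : adj (r N) (r N.+1) by apply: ray_adj.
suff fix_k k u : (dist (r N) u <= k)%N -> ahead r N u \/ u = r N -> g u = u.
  by apply: fix_k (leqnn _) _; left.
elim: k u => [|k IH] u.
  by rewrite leqn0 => /eqP/dist_eq0 <- _; apply: gr; lia.
move=> du [hu|->]; last by apply: gr; lia.
have [w [uw dw hw]] := half_tree_parent rN hu.
have wu : adj w u by rewrite adj_sym.
have gw : g w = w by apply: IH; [lia|].
case: hw => [hw|ew].
  have [x [wx dx hx]] := half_tree_parent rN hw.
  apply: (@fixes_nbrs g w x) => //; first by apply: (hN0 N) => //; lia.
  by apply: IH; [lia|].
suff -> : u = r N.+1 by apply: gr; lia.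
apply/dist_eq0; move/(aheadP _ _ rr): hu; rewrite dist_sym in dw *.
by rewrite dw ew distxx; lia.
Qed.

Lemma fixes_ahead_tail (g : tree_aut T) r N : ray r -> fixes_on g (ahead r N) ->
  cofinal_rays (g \o r) r.
Proof.
move=> rr gN; exists N.+1, N.+1 => k /=; apply: gN; apply/ahead_rayP => //; lia.
Qed.

Lemma fixes_ahead_germ (g : GFF c F F') xi r N : end_rays xi r ->
  fixes_on g (ahead r N) -> germ_stabilizer xi g.
Proof.
move=> xr gN; have rr := end_rays_ray xr.
have : nbhs xi (ends_of (ahead r N)).
  apply: open_nbhs_nbhs; split; first by apply: open_ends_of; apply: ray_adj.
  by apply/(ends_ofP xr (ray_adj N rr)); exists N.
apply: filterS => eta [s es sN]; apply: (cofinal_fixes_end es).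
by exists 0%N, 0%N => k /=; apply: gN.
Qed.

End prescribed_local_action.
Section side_branches.
Variable T : tree.
Implicit Types (z : T) (r : nat -> T).

(** The neighbour of [r n] on the way to another vertex of the ray lies on the ray
    too. For [n = 0] the vertex [r n.-1] is [r n] itself. *)
Lemma side_branch_off_ray r n z : ray r -> adj (r n) z -> z <> r n.+1 -> z <> r n.-1 ->
  forall j, ~ half_tree (r n) z (r j).
Proof.
move=> rr nz zn zp j /half_treeP => /(_ nz) d.
have dz : dist (r j) (r n) = (dist (r j) z).+1.
  by have := dist_adj_cases (r j) nz; lia.
have [jn|nj|jn] := ltngtP j n; last by rewrite jn distxx in dz.
  apply: zp; apply: (@closer_unique _ (r j) (r n)) => //.
    by rewrite adj_sym -{2}(ltn_predK jn); apply: ray_adj.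
  have := ray_dist j (n - j) rr; have := ray_dist j (n.-1 - j) rr.
  by rewrite !subnKC; lia.
apply: zn; apply: (@closer_unique _ (r j) (r n)) => //; first exact: ray_adj.
have := ray_dist n (j - n) rr; have := ray_dist n.+1 (j - n.+1) rr.
by rewrite !subnKC ?(ltnW nj) // (dist_sym (r j) (r n)) (dist_sym (r j)); lia.
Qed.

Lemma side_branch_sub r n z N : ray r -> adj (r n) z -> z <> r n.-1 -> (N < n)%N ->
  half_tree (r n) z `<=` ahead r N.
Proof.
move=> rr nz zp Nn; apply: half_tree_sub => //.
- exact: ray_adj.
- exact/ahead_rayP.
case: (dist_adj_cases (r N) nz) => // d; case: zp.
apply: (@closer_unique _ (r N) (r n)) => //.
  by rewrite adj_sym -{2}(ltn_predK Nn); apply: ray_adj.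
have := ray_dist N (n - N) rr; have := ray_dist N (n.-1 - N) rr.
by rewrite !subnKC; lia.
Qed.

End side_branches.

Section branching.
Variables (T : tree) (Omega : finType) (c : colouring T Omega).
Hypothesis Omega_gt3 : (3 < #|Omega|)%N.
Implicit Types (u v w x y z : T) (r s : nat -> T) (xi eta : tree_end T).

Lemma other_nbr v x y z : exists w, [/\ adj v w, w <> x, w <> y & w <> z].
Proof.
have [e [ex ey ez]] := other_colour (c v x) (c v y) (c v z) Omega_gt3.
exists (nbr c v e); rewrite nbr_adj; split=> // ew;
  [apply: ex|apply: ey|apply: ez]; by rewrite -ew colour_nbr.
Qed.

Lemma ray_from_edge x y : adj x y -> exists r, [/\ ray r, r 0 = x & r 1 = y].
Proof.
move=> xy; pose next (e : T * T) := sval (cid (other_nbr e.2 e.1 e.1 e.1)).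
have nextP e : adj e.2 (next e) /\ next e <> e.1.
  by rewrite /next; case: cid => w [].
pose step (e : T * T) := (e.2, next e).
pose r k := (iter k step (x, y)).1.
have r1 k : r k.+1 = (iter k step (x, y)).2 by [].
exists r; split=> //; apply: nonbacktracking_ray => k.
  by case: k => [//|k]; rewrite !r1; case: (nextP (iter k step (x, y))).
by rewrite r1 /= => e; case: (nextP (iter k step (x, y))).2.
Qed.

(** An automorphism that translates along [r] moves the branches off [r], so it
    cannot fix all ends in a neighbourhood of the end of [r]. *)
Lemma germ_fixes_tail (g : tree_aut T) xi r : end_rays xi r ->
  (\forall eta \near xi, end_map g eta = eta) ->
  exists M, forall k, (M <= k)%N -> g (r k) = r k.
Proof.
move=> xr near; have rr := end_rays_ray xr.
have [m [n gr]] := fixes_end xr (nbhs_singleton near).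
have [N hN] := nbhs_endP xr near.
suff mn : m = n by exists m => k /subnKC <-; rewrite [LHS]gr mn.
(* At [r K] and beyond, side branches of [r] lie in the given neighbourhood and
   the ray is shifted. *)
apply: contrapT => mn; pose K := (maxn N m).+1; pose K' := (K - m + n)%N.
have gK j : (m <= j)%N -> g (r j) = r (n + (j - m))%N.
  by move=> mj; rewrite -{1}(subnKC mj) [LHS]gr.
have [z [Kz zs zp _]] := other_nbr (r K) (r K.+1) (r K.-1) (r K).
have gKE : g (r K) = r K' by rewrite gK; [congr r|]; rewrite /K' /K; lia.
have Kz' : adj (r K') (g z) by rewrite -gKE aut_adj.
have [s [ss s0 s1]] := ray_from_edge Kz.
have sA : ahead s 0 = half_tree (r K) z by rewrite /ahead s0 s1.
have off : ~ half_tree (r K) z (r K') by apply: side_branch_off_ray.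
have off' : ~ half_tree (r K') (g z) (r K).
  apply: side_branch_off_ray => // e; [apply: zs|apply: zp];
    apply: (bij_inj (aut_bij g)); rewrite e gK; (try congr r); rewrite /K' /K; lia.
have /hN/(fixes_end (end_of_rayP ss)) : ends_of (ahead r N) (end_of_ray ss).
  apply/(ends_ofP (end_of_rayP ss) (ray_adj N rr)); exists 0%N.
  by rewrite sA; apply: side_branch_sub => //; rewrite /K; lia.
case=> i [j /(_ 1%N) /= gs]; set v := s (j + 1)%N in gs.
have vA : half_tree (r K) z v by rewrite -sA; apply/ahead_rayP => //; lia.
have vB : half_tree (r K') (g z) v.
  rewrite -gs -gKE -aut_half_tree //; exists (s (i + 1)%N) => //.
  by rewrite -sA; apply/ahead_rayP => //; lia.
have := dist_across Kz vA; rewrite -half_treeC // => /(_ _ off).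
have := dist_across Kz' vB; rewrite -half_treeC // => /(_ _ off').
move/half_treeP: vA => /(_ Kz); move/half_treeP: vB => /(_ Kz').
have D : dist (r K) (r K') <> 0%N.
  by move/dist_eq0; apply: ray_neq => //; rewrite /K' /K; lia.
have := dist_sym (r K) (r K').
have := dist_adj_cases v Kz; have := dist_adj_cases v Kz'; lia.
Qed.

End branching.

(** * The Gleason cover of the space of ends *)

Section decided_sets.
Variables (T : tree) (Omega : finType) (c : colouring T Omega).
Hypothesis Omega_gt3 : (3 < #|Omega|)%N.
Implicit Types (u v w x y z : T) (r s : nat -> T) (A B : set T).

(** Half-trees correspond to the basic open sets of ends, so these sets of
    vertices stand for nowhere dense sets of ends. *)
Definition null A := forall x y, adj x y ->
  exists x' y', adj x' y' /\ half_tree x' y' `<=` half_tree x y `\` A.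

(** Sets with nowhere dense boundary; modulo [null] sets they stand for the
    regular open sets of ends. *)
Definition decided A := forall x y, adj x y ->
  exists x' y', [/\ adj x' y', half_tree x' y' `<=` half_tree x y &
    half_tree x' y' `<=` A \/ half_tree x' y' `<=` ~` A].

Lemma null_decided A : null A -> decided A.
Proof.
move=> nA x y /nA[x' [y' [xy' sub]]]; exists x', y'; split=> //.
  by move=> v /sub[].
by right=> v /sub[].
Qed.

Lemma nullU A B : null A -> null B -> null (A `|` B).
Proof.
move=> nA nB x y /nA[x1 [y1 [/nB[x2 [y2 [xy2 s2]]] s1]]].
by exists x2, y2; split=> // v /s2[/s1[vH vA] vB]; split=> // -[].
Qed.

Lemma null_sub A B : A `<=` B -> null B -> null A.
Proof.
move=> AB nB x y /nB[x' [y' [xy' sub]]]; exists x', y'; split=> // v /sub[vH vB].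
by split=> // /AB.
Qed.

Lemma null0 : null set0.
Proof. by move=> x y xy; exists x, y; split=> // v hv; split=> // -[]. Qed.

Lemma decidedC A : decided A -> decided (~` A).
Proof.
move=> dA x y /dA[x' [y' [xy' sub h]]]; exists x', y'; rewrite setCK; split=> //.
by case: h; [right|left].
Qed.

Lemma decidedI A B : decided A -> decided B -> decided (A `&` B).
Proof.
move=> dA dB x y /dA[x1 [y1 [/dB[x2 [y2 [xy2 s2 h2]]] s1 h1]]].
exists x2, y2; split=> //; first exact: subset_trans s1.
case: h1 => h1; last by right=> v /s2/h1 nA -[].
by case: h2 => h2; [left=> v h; split; [apply/h1/s2|apply: h2]|right=> v /h2 nB -[]].
Qed.

Lemma decided_preimage (g : tree_aut T) A : decided A -> decided (g @^-1` A).
Proof.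
move=> dA x y xy; have /dA[x' [y' [xy' sub h]]] : adj (g x) (g y) by rewrite aut_adj.
have ixy' : adj (aut_inv g x') (aut_inv g y') by rewrite aut_adj.
have E : half_tree (aut_inv g x') (aut_inv g y') = g @^-1` half_tree x' y'.
  by rewrite -(aut_preimage_half_tree g ixy') /= !aut_Kinv.
exists (aut_inv g x'), (aut_inv g y'); split=> //.
  by rewrite E -[half_tree x y](aut_preimage_half_tree g xy) => v; apply: sub.
by rewrite E; case: h => h; [left|right] => v; apply: h.
Qed.

Lemma null_preimage (g : tree_aut T) A : null A -> null (g @^-1` A).
Proof.
move=> nA x y xy; have /nA[x' [y' [xy' sub]]] : adj (g x) (g y) by rewrite aut_adj.
have ixy' : adj (aut_inv g x') (aut_inv g y') by rewrite aut_adj.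
exists (aut_inv g x'), (aut_inv g y'); split=> // v.
rewrite -[half_tree x y](aut_preimage_half_tree g xy).
by rewrite -[half_tree (_ x') _](aut_preimage_half_tree g ixy') /= !aut_Kinv => /sub.
Qed.

Lemma not_in_side_branch v w u : adj v w -> adj v u -> u <> w -> ~ half_tree v w u.
Proof.
move=> vw vu uw /half_treeP => /(_ vw); rewrite (dist_sym u v) (dist_adj vu).
by case E: (dist u w) => [|//] _; apply: uw; apply: dist_eq0.
Qed.

Lemma sub_half_tree x y v u1 u2 : adj x y -> half_tree x y v ->
  exists w, [/\ adj v w, half_tree v w `<=` half_tree x y, w <> u1 & w <> u2].
Proof.
move=> xy vxy; have xv : x != v.
  by apply/eqP => xv; rewrite -xv in vxy; exact: half_tree_root vxy.
have [v' vv' dv'] := closer_exists xv.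
have [w [vw wv' w1 w2]] := other_nbr c Omega_gt3 v v' u1 u2.
exists w; split=> //; apply: half_tree_sub => //.
by case: (dist_adj_cases x vw) => // d; case: wv'; apply: closer_unique d dv'.
Qed.

(** A half-tree that avoids all vertices of a ray lies on one side of each of
    its edges, so it cannot tell apart anything defined by those sides. *)
Lemma decided_ray_levels r A : ray r ->
  (forall v w, (forall k, ahead r k v <-> ahead r k w) -> A v -> A w) -> decided A.
Proof.
move=> rr hA.
suff gen x y : adj x y -> (forall k, ~ half_tree x y (r k)) ->
    half_tree x y `<=` A \/ half_tree x y `<=` ~` A.
  move=> x y xy; have [[k hk]|no] := pselect (exists k, half_tree x y (r k)).
    have [w [kw sub w1 w2]] := sub_half_tree (r k.+1) (r k.-1) xy hk.
    by exists (r k), w; split=> //; apply: gen => // j; exact: side_branch_off_ray.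
  by exists x, y; split=> //; apply: gen => // k hk; apply: no; exists k.
move=> xy off.
have same v w k : half_tree x y v -> half_tree x y w -> ahead r k v -> ahead r k w.
  move=> hv hw; have rk := ray_adj k rr.
  have [sub _|sub] := half_tree_side xy rk (off k) (off k.+1); first exact: sub.
  by have := sub _ hv; rewrite -half_treeC.
have [yA|yA] := pselect (A y); [left|right] => v hv.
  by apply: hA yA => k; split; apply: same => //; apply: half_tree_tip.
by move=> vA; apply/yA/(hA v) => // k; split; apply: same => //; apply: half_tree_tip.
Qed.

(** Every half-tree contains a half-tree that avoids both endpoints of a given
    edge and hence lies on one side of it. *)
Lemma decided_half_tree x y : adj x y -> decided (half_tree x y).
Proof.
move=> xy a b ab.
suff [a' [b' [ab' sub xn yn]]] : exists a' b', [/\ adj a' b',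
    half_tree a' b' `<=` half_tree a b, ~ half_tree a' b' x & ~ half_tree a' b' y].
  exists a', b'; split=> //; rewrite half_treeC //.
  exact: half_tree_side.
have [hx|xn] := pselect (half_tree a b x).
  have [w [xw sub wy _]] := sub_half_tree y y ab hx.
  exists x, w; split=> //; first exact: half_tree_root.
  by apply: not_in_side_branch => // e; apply: wy.
have [hy|yn] := pselect (half_tree a b y); last by exists a, b; split.
have [w [yw sub wx _]] := sub_half_tree x x ab hy.
exists y, w; split=> //; last exact: half_tree_root.
by apply: not_in_side_branch => //; [rewrite adj_sym|move=> e; apply: wx].
Qed.

Lemma null_set1 v : null [set v].
Proof.
move=> x y xy; have [w [yw sub _ _]] := sub_half_tree y y xy (half_tree_tip xy).
have [w' [yw' sub' ww' _]] := sub_half_tree w w xy (half_tree_tip xy).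
have [vw|vw] := pselect (half_tree y w v).
  exists y, w'; split=> // u hu; split; first exact: sub'.
  move=> /= uv; rewrite uv in hu.
  have : (half_tree y w `&` half_tree y w') v by [].
  by rewrite half_tree_disjoint // => e; apply: ww'.
by exists y, w; split=> // u hu; split; [apply: sub|move=> /= uv; rewrite uv in hu].
Qed.

(** This makes the cover an irreducible extension of the space of ends, so that
    extreme proximality lifts to it. *)
Lemma not_null_half_tree A : decided A -> ~ null A ->
  exists x y, adj x y /\ half_tree x y `<=` A.
Proof.
move=> dA nA; apply: contrapT => no; apply: nA => x y /dA[x' [y' [xy' sub h]]].
exists x', y'; split=> //; case: h => h; first by case: no; exists x', y'.
by move=> v hv; split; [apply: sub|apply: h].
Qed.

Lemma half_tree_not_null x y : adj x y -> ~ null (half_tree x y).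
Proof. by move=> xy /(_ _ _ xy)[a [b [ab /(_ b (half_tree_tip ab))[]]]]. Qed.

End decided_sets.

(** The Stone space of the algebra of decided sets modulo null sets. *)
Record cover_point (T : tree) := CoverPoint {
  cover_sets :> set T -> Prop ;
  cover_decided : forall A, cover_sets A -> decided A ;
  cover_not_null : forall A, cover_sets A -> ~ null A ;
  coverI : forall A B, cover_sets A -> cover_sets B -> cover_sets (A `&` B) ;
  cover_ultra : forall A, decided A -> cover_sets A \/ cover_sets (~` A)
}.

Lemma cover_point_eq (T : tree) (p q : cover_point T) : cover_sets p = cover_sets q -> p = q.
Proof.
case: p q => [P a1 a2 a3 a4] [Q b1 b2 b3 b4] /= e; subst Q.
by congr CoverPoint; apply: Prop_irrelevance.
Qed.

HB.instance Definition _ (T : tree) := gen_eqMixin (cover_point T).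
HB.instance Definition _ (T : tree) := gen_choiceMixin (cover_point T).

Definition cover_basic (T : tree) (A : set T) : set (cover_point T) :=
  [set p : cover_point T | cover_sets p A].

HB.instance Definition _ (T : tree) :=
  @isSubBaseTopological.Build (cover_point T) (set T) (@decided T) (@cover_basic T).

Section cover_space.
Variables (T : tree) (Omega : finType) (c : colouring T Omega).
Hypothesis Omega_gt3 : (3 < #|Omega|)%N.
Implicit Types (u v w x y z : T) (r s : nat -> T) (A B : set T).
Implicit Types (p q : cover_point T).

Lemma cover0 p : ~ p set0.
Proof. by move=> /cover_not_null; apply; apply: null0. Qed.

Lemma cover_disjoint p A B : p A -> p B -> A `&` B !=set0.
Proof.
move=> pA pB; apply/set0P/negP => /eqP AB.
by apply: (@cover0 p); rewrite -AB; apply: coverI.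
Qed.

Lemma cover_setC p A : p A -> ~ p (~` A).
Proof. by move=> pA /(cover_disjoint pA)[v []]. Qed.

Lemma cover_up p A B : decided B -> A `<=` B -> p A -> p B.
Proof.
move=> dB AB pA; case: (cover_ultra p dB) => // /(cover_disjoint pA)[v [/AB]] //.
Qed.

Lemma open_cover_basic A : decided A -> open (cover_basic A).
Proof. exact: (@subbase_open _ _ (@decided T)). Qed.

Lemma cover_basicC A : decided A -> ~` cover_basic A = cover_basic (~` A).
Proof.
move=> dA; apply/seteqP; split=> p /=.
  by case: (cover_ultra p dA).
by move=> pC pA; apply: cover_setC pC.
Qed.

Lemma nbhs_coverP p (W : set (cover_point T)) : nbhs p W ->
  exists A, p A /\ cover_basic A `<=` W.
Proof.
rewrite nbhsE => -[V [oV Vp] VW].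
pose Phi := [set Q : set (cover_point T) | exists A, p A /\ cover_basic A `<=` Q].
have FPhi : Filter Phi.
  split.
  - have d0 : decided (@set0 T) by apply/null_decided/null0.
    by have [/cover0 //|pT] := cover_ultra p d0; exists (~` set0).
  - move=> P Q [A [pA AP]] [B [pB BQ]]; exists (A `&` B); split; first exact: coverI.
    move=> q qAB; split; [apply: AP|apply: BQ].
      by apply: cover_up qAB; [exact: cover_decided pA|move=> v []].
    by apply: cover_up qAB; [exact: cover_decided pB|move=> v []].
  - by move=> P Q PQ [A [pA AP]]; exists A; split=> //; apply: subset_trans PQ.
have [A [pA AV]] : Phi V.
  by apply: (subbase_nbhs oV Vp FPhi) => A dA pA; exists A; split.
by exists A; split=> //; apply: subset_trans VW.
Qed.

Lemma cover_space_hausdorff : hausdorff_space (cover_point T).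
Proof.
rewrite open_hausdorff => p q pq.
have [A [dA pA qA]] : exists A, [/\ decided A, p A & q (~` A)].
  apply: contrapT => no; case/eqP: pq; apply: cover_point_eq; apply/seteqP.
  split=> A hA; have dA := cover_decided hA.
    by case: (cover_ultra q dA) => // qA; case: no; exists A.
  case: (cover_ultra p dA) => // pA; case: no; exists (~` A); rewrite setCK.
  by split=> //; apply: decidedC.
exists (cover_basic A, cover_basic (~` A)) => /=; first by split; apply: mem_set.
split; [exact: open_cover_basic|apply: open_cover_basic; exact: decidedC|].
by apply/eqP; rewrite -subset0 => s [/cover_setC].
Qed.

(** The limit of an ultrafilter [U] on the space consists of the sets that belong to
    [U]-almost all points. *)
Lemma cover_space_compact : compact [set: cover_point T].
Proof.
rewrite compact_ultra => U FU _.
have decP A (H : U (cover_basic A)) : decided A.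
  by have [q] := filter_ex H; apply: cover_decided.
have nnP A (H : U (cover_basic A)) : ~ null A.
  by have [q] := filter_ex H; apply: cover_not_null.
have interP A B : U (cover_basic A) -> U (cover_basic B) -> U (cover_basic (A `&` B)).
  by move=> UA UB; apply: filterS2 UA UB => q; apply: coverI.
have ultraP A : decided A -> U (cover_basic A) \/ U (cover_basic (~` A)).
  by move=> dA; rewrite -cover_basicC //; apply: in_ultra_setVsetC.
pose p := @CoverPoint T [set A | U (cover_basic A)] decP nnP interP ultraP.
exists p; split=> // W /nbhs_coverP[A [pA AW]].
exact: filterS AW pA.
Qed.

Definition cover_act (g : tree_aut T) p : cover_point T.
Proof.
apply: (@CoverPoint T [set A | p (g @^-1` A)]).
- move=> A /cover_decided/(decided_preimage (aut_inv g)).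
  by rewrite -comp_preimage (_ : _ \o _ = id) //; apply/funext => v /=; rewrite aut_Kinv.
- by move=> A /cover_not_null nA /(null_preimage g).
- by move=> A B /= pA pB; rewrite preimage_setI; apply: coverI.
- by move=> A /(decided_preimage g)/(cover_ultra p).
Defined.

Lemma cover_actE g p A : cover_act g p A = p (g @^-1` A).
Proof. by []. Qed.

Lemma cover_act_half_tree g p x y : adj x y ->
  cover_act g p (half_tree (g x) (g y)) = p (half_tree x y).
Proof. by move=> xy; rewrite cover_actE aut_preimage_half_tree. Qed.

Lemma cover_act1 p : cover_act 1%g p = p.
Proof. by apply: cover_point_eq; apply/seteqP; split=> A. Qed.

Lemma cover_actM g h p : cover_act (g * h)%g p = cover_act g (cover_act h p).
Proof. by apply: cover_point_eq; apply/seteqP; split=> A. Qed.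

Lemma cover_act_continuous g : continuous (cover_act g).
Proof.
move=> p W /nbhs_coverP[A [pA AW]].
rewrite -[nbhs _ W]/(nbhs p (cover_act g @^-1` W)).
apply: (@filterS _ (nbhs p) _ (cover_basic (g @^-1` A))); first by move=> q qA; apply: AW.
apply: open_nbhs_nbhs; split=> //; apply: open_cover_basic; exact: (@cover_decided T p _ pA).
Qed.

Lemma open_cover_half_tree (W : set (cover_point T)) : open W -> W !=set0 ->
  exists x y, adj x y /\ cover_basic (half_tree x y) `<=` W.
Proof.
move=> oW [p Wp]; have /nbhs_coverP[A [pA AW]] : nbhs p W by apply: open_nbhs_nbhs.
have dA := cover_decided pA.
have [x [y [xy sub]]] := not_null_half_tree dA (cover_not_null pA).
exists x, y; split=> // q qH; apply: AW; exact: cover_up qH.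
Qed.

Definition lies_over p r := ray r /\ forall n, p (ahead r n).

(** The half-trees ahead on [r] generate, together with the complements of null
    sets, a proper filter, and any ultrafilter on the vertices above it gives a
    point. *)
Lemma lies_over_exists r : ray r -> exists p, lies_over p r.
Proof.
move=> rr.
pose Phi := [set A : set T | exists n N, null N /\ ahead r n `\` N `<=` A].
have PPhi : ProperFilter Phi.
  split.
    case=> n [N [nN sub]]; apply: (half_tree_not_null (ray_adj n rr)).
    apply: null_sub nN => v hv; apply: contrapT => vN; exact: (sub v).
  split.
  - by exists 0, set0; split=> //; apply: null0.
  - move=> A B [n [N [nN NA]]] [m [M [nM MB]]]; exists (maxn n m), (N `|` M).
    split; first exact: nullU.
    move=> v [hv /not_orP[vN vM]]; split; [apply: NA|apply: MB]; split=> //;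
      move: v hv {vN vM}; apply: ahead_decr => //; lia.
  - by move=> A B AB [n [N [nN NA]]]; exists n, N; split=> //; apply: subset_trans AB.
have [U [UU PU]] := ultraFilterLemma PPhi.
have UC A : U A -> ~ U (~` A).
  by move=> UA UAC; have [v []] := filter_ex (filterI UA UAC).
have h1 A : (decided A /\ U A) -> decided A by case.
have h2 A : (decided A /\ U A) -> ~ null A.
  by move=> [_ UA] nA; apply: (UC _ UA); apply: PU; exists 0, A; split=> // v [].
have h3 A B : (decided A /\ U A) -> (decided B /\ U B) -> decided (A `&` B) /\ U (A `&` B).
  by move=> [dA UA] [dB UB]; split; [apply: decidedI|apply: filterI].
have h4 A : decided A -> (decided A /\ U A) \/ (decided (~` A) /\ U (~` A)).
  move=> dA; have dC := decidedC dA; have [UA|UA] := in_ultra_setVsetC A UU.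
    by left.
  by right.
exists (@CoverPoint T [set A | decided A /\ U A] h1 h2 h3 h4); split=> // n; split.
  by apply: (decided_half_tree c Omega_gt3); apply: ray_adj.
by apply: PU; exists n, set0; split; [exact: null0|move=> v []].
Qed.

(** Otherwise [p] would contain the complements of all half-trees at [v], and so the
    set [[set v]], which is null. *)
Lemma cover_next p v : exists w, adj v w /\ p (half_tree v w).
Proof.
apply: contrapT => no.
suff : p [set v] by move/cover_not_null; apply; exact: (null_set1 c Omega_gt3).
have all_out (S : seq Omega) :
    p [set u | forall a, a \in S -> ~ half_tree v (nbr c v a) u].
  elim: S => [|a S IH].
    have d0 : decided (@set0 T) by apply/null_decided/null0.
    have [/cover0 //|] := cover_ultra p d0; congr (cover_sets p _).
    by apply/seteqP; split=> [u _ a|u _ []]; rewrite ?in_nil.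
  have va := nbr_adj c v a.
  have [ha|na] := cover_ultra p (decided_half_tree c Omega_gt3 va).
    by case: no; exists (nbr c v a).
  move: (coverI na IH); congr (cover_sets p _); apply/seteqP; split=> u /=.
    by move=> [ua uS] b; rewrite inE => /orP[/eqP ->|/uS].
  by move=> h; split=> [|b bS]; apply: h; rewrite inE ?eqxx // bS orbT.
move: (all_out (enum Omega)); congr (cover_sets p _); apply/seteqP; split=> u /=; last first.
  by move=> -> a _; apply/half_tree_root/nbr_adj.
move=> out; apply: contrapT => uv; have /closer_exists[w vw dw] : u != v by apply/eqP.
apply: (out (c v w)); rewrite ?mem_enum // nbr_colour //.
by apply/half_treeP => //; rewrite dw.
Qed.

Lemma cover_ray p : exists r, lies_over p r.
Proof.
case: (tree_nonempty T) => v0.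
pose next v := sval (cid (cover_next p v)).
have nextP v : adj v (next v) /\ p (half_tree v (next v)).
  by rewrite /next; case: cid.
exists (fun n => iter n next v0); split; last by move=> n; case: (nextP (iter n next v0)).
apply: nonbacktracking_ray => k; first by case: (nextP (iter k next v0)).
have [a1 p1] := nextP (iter k next v0); have [a2 p2] := nextP (iter k.+1 next v0).
by move=> e; apply: (cover_setC p1); rewrite half_treeC // {2}e.
Qed.

Lemma lies_over_cofinal p r s : lies_over p r -> lies_over p s -> cofinal_rays r s.
Proof.
by move=> [rr pr] [ss ps]; apply: rays_cofinal => // n m; apply: (cover_disjoint (p := p)).
Qed.

Lemma lies_over_end p r s : lies_over p r -> ray s -> cofinal_rays r s -> lies_over p s.
Proof.
move=> [rr pr] ss [m [n rs]]; split=> // k.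
apply: (@cover_up p (ahead r (m + k))) => //.
  by apply: (decided_half_tree c Omega_gt3); apply: ray_adj.
by rewrite (cofinal_ahead _ rs); apply: ahead_decr => //; lia.
Qed.

Lemma lies_over_act g p r : lies_over p r -> lies_over (cover_act g p) (g \o r).
Proof.
move=> [rr pr]; split=> [|n]; first exact: aut_ray.
by have := pr n; rewrite -(cover_act_half_tree g p (ray_adj n rr)).
Qed.

Lemma cover_fixed_cofinal g p r : lies_over p r -> cover_act g p = p -> cofinal_rays (g \o r) r.
Proof. by move=> pr gp; apply: (@lies_over_cofinal p) => //; rewrite -gp; apply: lies_over_act. Qed.

(** Cut the tree along [r] into blocks of [l] consecutive levels: [g] moves every
    block to the next one, so it exchanges even and odd blocks near the end of
    [r], and a point over this end has to choose between the two. *)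
Lemma shift_no_fixpoint (g : tree_aut T) p r l : lies_over p r -> (0 < l)%N ->
  (forall k, g (r k) = r (l + k)%N) -> cover_act g p <> p.
Proof.
move=> [rr pr] l0 gr gp.
pose level v L := forall k, ahead r k v <-> (k <= L)%N.
pose A := [set v | exists2 L, level v L & ~~ odd (L %/ l)].
have dA : decided A.
  apply: (decided_ray_levels c Omega_gt3 rr) => v w vw [L vL oL]; exists L => // k.
  by rewrite -vw.
have levelP v : ahead r 0 v -> exists L, level v L.
  move=> v0; have [N hN] := ahead_escape v rr.
  have ex : exists n, `[< ~ ahead r n v >] by exists N; apply/asboolP/hN.
  case: (ex_minnP ex) => -[/asboolP //|L] /asboolP nL Lmin; exists L => k; split.
    move=> hk; rewrite leqNgt; apply/negP => Lk; apply: nL.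
    by move: v hk {v0 hN ex Lmin}; apply: ahead_decr.
  by move=> kL; apply: contrapT => /asboolP/Lmin; lia.
have level_uniq v L L' : level v L -> level v L' -> L = L'.
  move=> h h'; apply/eqP; rewrite eqn_leq.
  by apply/andP; split; [apply/h'/h|apply/h/h'].
have gahead k v : ahead r (l + k) (g v) <-> ahead r k v.
  by rewrite /ahead -addnS -!gr -(aut_preimage_half_tree g (ray_adj k rr)).
have level_shift v L : level v L -> level (g v) (l + L).
  move=> vL k; have [kl|lk] := leqP l k.
    by rewrite -(subnKC kl) gahead vL; lia.
  split=> [|_]; first lia; suff : ahead r (l + 0) (g v).
    by move: (g v); apply: ahead_decr => //; lia.
  by apply/gahead/vL.
have oddS L : odd ((l + L) %/ l) = ~~ odd (L %/ l).
  by rewrite divnDl ?dvdnn // divnn l0 oddD.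
have swap v : ahead r 0 v -> A v <-> ~ A (g v).
  move=> /levelP[L vL]; have gvL := level_shift _ _ vL; split.
    move=> [L1 /level_uniq/(_ vL) -> oL] [L2 /level_uniq/(_ gvL) ->].
    by rewrite oddS oL.
  move=> nA; exists L => //; apply/negP => oL; apply: nA; exists (l + L)%N => //.
  by rewrite oddS oL.
have gA B : p B <-> p (g @^-1` B) by rewrite -cover_actE gp.
case: (cover_ultra p dA) => pA.
  have [v [[vA gvA] v0]] := cover_disjoint (coverI pA ((gA _).1 pA)) (pr 0).
  by move/swap: vA; apply.
have [v [[vA gvA] v0]] := cover_disjoint (coverI pA ((gA _).1 pA)) (pr 0).
by apply: vA; apply/swap.
Qed.

(** The element acts on a ray below its fixed point by a shift; a nontrivial shift
    or its inverse contradicts [shift_no_fixpoint]. *)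
Lemma cover_fixed_elliptic g p : cover_act g p = p -> elliptic g.
Proof.
move=> gp; have [r pr] := cover_ray p; have rr := pr.1.
have [m [n gr]] := cover_fixed_cofinal pr gp.
have shifted j : lies_over p (fun k => r (j + k)%N).
  by apply: lies_over_end pr _ _; [exact: ray_shift|exists j, 0].
have [mn|nm|mn] := ltngtP m n.
- case: (@shift_no_fixpoint g p (fun k => r (m + k)%N) (n - m)) => //.
    by rewrite subn_gt0.
  by move=> k; rewrite [LHS]gr; congr r; lia.
- have ip : cover_act g^-1%g p = p by rewrite -{1}gp -cover_actM mulVg cover_act1.
  case: (@shift_no_fixpoint g^-1%g p (fun k => r (n + k)%N) (m - n)) => //.
    by rewrite subn_gt0.
  move=> k; rewrite -[r (n + k)%N]gr /= aut_invK; congr r; lia.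
- by left; exists (r m); have := gr 0; rewrite mn !addn0.
Qed.

End cover_space.

(** * Borel probabilities on a compact space *)

Section borel_probabilities.
Variables (R : realType) (X : ptopologicalType).
Local Notation borel := (g_sigma_algebraType (@open X)).

Lemma build_prob (nu : set borel -> \bar R) : nu set0 = 0%E ->
  (forall A, 0 <= nu A)%E -> semi_sigma_additive nu -> nu setT = 1%E ->
  exists P : Prob R X, forall A, P A = nu A.
Proof.
move=> nu0 nu_ge0 nu_add nuT.
pose M : measure borel R := HB.pack nu (isMeasure.Build _ borel R nu nu0 nu_ge0 nu_add).
pose P : probability borel R := HB.pack (Measure.sort M) (Measure_isProbability.Build _ borel R M nuT).
by exists P.
Qed.

Lemma prob_le (nu : Prob R X) (A B : set borel) : measurable A -> measurable B ->
  A `<=` B -> (nu A <= nu B)%E.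
Proof. by move=> mA mB; apply: le_measure; apply: mem_set. Qed.

Lemma open_borel (U : set X) : open U -> measurable (U : set borel).
Proof. by move=> oU; apply: sub_sigma_algebra. Qed.

Lemma closed_borel (C : set X) : closed C -> measurable (C : set borel).
Proof. by move=> cC; rewrite -[C]setCK; apply: measurableC; exact: open_borel (closed_openC cC). Qed.

Lemma continuous_borel (h : X -> X) : continuous h ->
  measurable_fun setT (h : borel -> borel).
Proof.
move=> ch; apply: (@measurability _ _ borel borel setT h (@open X)) => // _ [V oV <-].
by rewrite setTI; apply: open_borel; apply: open_comp.
Qed.

Lemma continuous_real_borel (f : X -> R) : continuous f ->
  measurable_fun setT (f : borel -> R).
Proof.
move=> cf; apply: (@measurability _ _ borel (measurableTypeR R) setT f (@RGenOpens.G R)) => [|_ [_ [x [y ->]] <-]].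
  exact: RGenOpens.measurableE.
by rewrite setTI; apply: open_borel; apply: open_comp => //; apply: interval_open.
Qed.

Lemma push_prob (h : X -> X) (mu : Prob R X) : continuous h ->
  exists nu : Prob R X, forall A : set borel, measurable A -> nu A = mu (h @^-1` A).
Proof.
move=> ch; have mh := continuous_borel ch.
have [] := @build_prob (fun A => mu (h @^-1` A)).
- by rewrite preimage_set0 measure0.
- by move=> A; apply: measure_ge0.
- move=> A mA tA mUA; rewrite preimage_bigcup; apply: measure_semi_sigma_additive.
  + by move=> i; rewrite -[_ @^-1` _]setTI; apply: mh.
  + apply/trivIsetP => i j _ _ ij; rewrite -preimage_setI.
    by move/trivIsetP : tA => /(_ _ _ Logic.I Logic.I ij) ->; rewrite preimage_set0.
  + by rewrite -preimage_bigcup -[_ @^-1` _]setTI; apply: mh.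
- by rewrite preimage_setT probability_setT.
by move=> P PE; exists P.
Qed.

Local Open Scope ring_scope.

Hypothesis compactX : compact [set: X].

Lemma continuous_bounded (f : X -> R) : continuous f ->
  exists2 M : R, 0 < M & forall x, `|f x| <= M.
Proof.
move=> cf; have cfX : compact (f @` setT).
  by apply: continuous_compact => //; apply: continuous_subspaceT.
have [M [_ hM]] := compact_bounded cfX.
exists (Num.max 1 (M + 1)); first by rewrite lt_max ltr01.
by move=> x; apply: hM; [rewrite lt_max ltrDl ltr01 orbT|exists x].
Qed.

Lemma bounded_integrable (nu : Prob R X) (f : X -> R) (M : R) :
  measurable_fun setT (f : borel -> R) -> (forall x, `|f x| <= M) ->
  nu.-integrable setT (EFin \o f).
Proof.
move=> mf hM; apply: measurable_bounded_integrable => //.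
  by rewrite (_ : _ [set: _] = 1%E) ?ltry //; apply: probability_setT.
exists M; split; first exact: num_real.
by move=> N MN x _ /=; apply: le_trans (hM x) (ltW MN).
Qed.

Lemma continuous_integrable (nu : Prob R X) (f : X -> R) : continuous f ->
  nu.-integrable setT (EFin \o f).
Proof.
move=> cf; have [M _ hM] := continuous_bounded cf.
exact: bounded_integrable (continuous_real_borel cf) hM.
Qed.

Lemma indic_integrable (nu : Prob R X) (A : set borel) : measurable A ->
  nu.-integrable setT (EFin \o (\1_A : borel -> R)).
Proof.
move=> mA; apply: (@bounded_integrable _ _ 1); first exact: measurable_indic.
by move=> x; rewrite indicE; case: (_ \in _); rewrite ?normr1 ?normr0.
Qed.

Lemma Rintegral_indic (nu : Prob R X) (A : set borel) : measurable A ->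
  \int[nu]_x (\1_A x : R) = fine (nu A).
Proof. by move=> mA; rewrite /Rintegral integral_indic // setIT. Qed.

Lemma Rintegral_dirac (f : X -> R) x : continuous f ->
  \int[dirac_prob R x]_y f y = f x.
Proof.
move=> cf; rewrite /Rintegral integral_dirac //; last first.
  by apply/measurable_EFinP; apply: continuous_real_borel.
by rewrite diracT mul1e.
Qed.

(** Mass outside a small neighbourhood of [x] contributes at most twice the bound of
    [f] times that mass. *)
Lemma integral_concentrated (f : X -> R) x e : continuous f -> 0 < e ->
  exists V, [/\ open V, V x & exists2 d, 0 < d &
    forall nu : Prob R X, (nu (~` V) <= d%:E)%E -> `|\int[nu]_y f y - f x| < e].
Proof.
move=> cf e0; have [M M0 hM] := continuous_bounded cf.
pose V := f @^-1` ball (f x) (e / 2).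
have oV : open V by apply: open_comp => //; apply: ball_open.
exists V; split=> //; first by apply: ballxx; rewrite divr_gt0.
exists (e / (8 * M)); first by rewrite divr_gt0 // mulr_gt0.
move=> nu nuV; have mV : measurable (~` V : set borel).
  by apply: measurableC; apply: open_borel.
have intf := continuous_integrable nu cf.
have intc (k : R) : nu.-integrable setT (EFin \o cst k).
  by apply: continuous_integrable; apply: cst_continuous.
have intV := indic_integrable nu mV.
have intV2 : nu.-integrable setT (EFin \o (fun y : borel => 2 * M * \1_(~` V) y)).
  apply: (@bounded_integrable _ _ (2 * M)).
    by apply: measurable_funM; [exact: measurable_cst|exact: measurable_indic].
  move=> y; rewrite indicE; case: (_ \in _); rewrite ?mulr1 ?mulr0 ?normr0.
    by rewrite ger0_norm // mulr_ge0 // ltW.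
  by rewrite mulr_ge0 // ltW.
have nuT : fine (nu setT) = 1 by rewrite probability_setT.
have -> : f x = \int[nu]_y (cst (f x) y : R) by rewrite Rintegral_cst // nuT mulr1.
rewrite -RintegralB //.
have intD : nu.-integrable setT (EFin \o (fun y : borel => f y - cst (f x) y)).
  apply: continuous_integrable => y; apply: cvgB; [exact: cf|exact: cvg_cst].
apply: le_lt_trans (le_normr_Rintegral measurableT intD) _.
pose h := fun y : borel => cst (e / 2) y + 2 * M * \1_(~` V) y : R.
have inth : nu.-integrable setT (EFin \o h).
  by rewrite /h; apply: (integrableD measurableT (intc (e / 2)) intV2).
apply: (@le_lt_trans _ _ (\int[nu]_y h y)).
  apply: le_Rintegral => //.
    apply: continuous_integrable => y; apply: cvg_norm.
    by apply: cvgB; [exact: cf|exact: cvg_cst].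
  move=> y _; rewrite /h /= indicE; have [yV|yV] := pselect (V y).
    rewrite memNset ?mulr0 ?addr0; last by move=> /(_ yV).
    by rewrite distrC; apply: ltW; exact: yV.
  rewrite mem_set // mulr1; have := hM y; have := hM x => hx hy.
  have := ler_normB (f y) (f x); have : 0 < e / 2 by rewrite divr_gt0.
  by move: hx hy; lra.
rewrite RintegralD // Rintegral_cst // nuT mulr1 RintegralZl // Rintegral_indic //.
have : fine (nu (~` V)) <= e / (8 * M).
  by rewrite -lee_fin fineK //; apply: fin_num_measure.
move=> hV; have : 2 * M * fine (nu (~` V)) <= 2 * M * (e / (8 * M)).
  by rewrite ler_pM2l // mulr_gt0.
have -> : 2 * M * (e / (8 * M)) = e / 4 by field; rewrite gt_eqF.
lra.
Qed.

End borel_probabilities.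

(** * Extremely proximal actions are boundary actions *)

Section compressible_actions.
Variables (R : realType) (G : groupType) (X : ptopologicalType) (act : G -> X -> X).
Local Notation borel := (g_sigma_algebraType (@open X)).
Local Open Scope ring_scope.

Hypothesis compactX : compact [set: X].
Hypothesis hausX : hausdorff_space X.
Hypothesis actX : action_by_homeos act.
(* This property of an action is known as extreme proximality. *)
Hypothesis compress : forall C V : set X, closed C -> C <> setT -> open V -> V !=set0 ->
  exists g, act g @` C `<=` V.
Hypothesis split_open : forall V : set X, open V -> V !=set0 ->
  exists U1 U2, [/\ open U1 /\ open U2, U1 !=set0 /\ U2 !=set0,
    U1 `<=` V /\ U2 `<=` V & U1 `&` U2 = set0].

(** Of two disjoint open subsets one has at most half of the mass. *)
Lemma small_open (mu : Prob R X) n :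
  exists U : set X, [/\ open U, U !=set0 & (mu U <= ((1 / 2) ^+ n)%:E)%E].
Proof.
elim: n => [|n [V [oV V0 muV]]].
  exists setT; split; [exact: openT|by exists point|].
  by rewrite expr0; apply: probability_le1.
have [U1 [U2 [[oU1 oU2] [n1 n2] [s1 s2] dis]]] := split_open oV V0.
have m1 := open_borel oU1; have m2 := open_borel oU2.
have le : (mu U1 + mu U2 <= ((1 / 2) ^+ n)%:E)%E.
  rewrite -measureU //; apply: le_trans muV.
  apply: prob_le; [exact: measurableU|exact: open_borel|].
  by move=> y [/s1|/s2].
have f1 : mu U1 \is a fin_num by apply: fin_num_measure.
have f2 : mu U2 \is a fin_num by apply: fin_num_measure.
move: le; rewrite -(fineK f1) -(fineK f2) -EFinD lee_fin => le.
have [h|h] := leP (fine (mu U1)) (fine (mu U2)).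
  by exists U1; split=> //; rewrite -(fineK f1) lee_fin exprS; lra.
by exists U2; split=> //; rewrite -(fineK f2) lee_fin exprS; lra.
Qed.

(** Some nonempty open set has hardly any mass, and its complement can be pushed
    into any neighbourhood of any given point. *)
Lemma compressible_boundary : boundary_action act R.
Proof.
have split1 (x : X) : [set x] <> setT.
  move=> e; have [U1 [U2 [_ [[y y1] [z z2]] _ dis]]] := split_open openT (ex_intro _ x Logic.I).
  have ey : [set x] y by rewrite e.
  have ez : [set x] z by rewrite e.
  have : (U1 `&` U2) x by split; [rewrite -ey|rewrite -ez].
  by rewrite dis.
have close1 (x : X) : closed [set x].
  exact: accessible_closed_set1 (hausdorff_accessible hausX) x.
split=> //.
  move=> x V V0 oV; have [g gV] := compress (close1 x) (split1 x) oV V0.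
  by exists (act g x); split; [apply: gV; exists x|exists g].
move=> mu _; pose x : X := point; exists x.
pose Phi := [set Q : set (Prob R X) | exists V (d : R), [/\ open V, V x, 0 < d &
  forall nu : Prob R X, (nu (~` V) <= d%:E)%E -> Q nu]].
have FPhi : Filter Phi.
  split.
  - by exists setT, 1; split=> //; exact: openT.
  - move=> P Q [V [d [oV Vx d0 h]]] [V' [d' [oV' Vx' d0' h']]].
    exists (V `&` V'), (Num.min d d'); split=> //.
    + exact: openI.
    + by rewrite lt_min d0.
    + have mV := open_borel oV; have mV' := open_borel oV'.
      have le1 (nu : Prob R X) W : measurable (W : set borel) -> V `&` V' `<=` W ->
          (nu (~` (V `&` V')) <= (Num.min d d')%:E)%E -> (nu (~` W) <= (Num.min d d')%:E)%E.
        move=> mW VW; apply: le_trans; apply: prob_le.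
        - exact: measurableC.
        - by apply: measurableC; apply: measurableI.
        - exact: subsetC.
      move=> nu nuV; split; [apply: h|apply: h'].
        apply: le_trans (le1 nu V mV (@subIsetl _ _ _) nuV) _.
        by rewrite lee_fin ge_min lexx.
      apply: le_trans (le1 nu V' mV' (@subIsetr _ _ _) nuV) _.
      by rewrite lee_fin ge_min lexx orbT.
  - by move=> P Q PQ [V [d [oV Vx d0 h]]]; exists V, d; split=> // nu /h/PQ.
move=> Q; rewrite nbhsE => -[W [oW Wx] WQ].
suff [V [d [oV Vx d0 h]]] : Phi W.
  have [n nd] : exists n, (1 / 2) ^+ n < d.
    have /cvgrPdist_lt/(_ d d0)[n _ /(_ n (leqnn n))] : ((1 / 2 : R) ^+ k @[k --> \oo] --> 0).
      by apply: cvg_expr; rewrite ger0_norm; lra.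
    by rewrite sub0r normrN => hn; exists n; apply: le_lt_trans hn; apply: ler_norm.
  have [U [oU U0 muU]] := small_open mu n.
  have [g gV] : exists g, act g @` (~` U) `<=` V.
    apply: compress => //; [exact: open_closedC| |by exists x].
    by move=> UT; case: U0 => y yU; have : (~` U) y by rewrite UT.
  have cg : continuous (act g) by case: actX.
  have [nu nuE] := push_prob mu cg.
  exists nu; split; first by exists g.
  apply: WQ; apply: h.
  have mV : measurable (V : set borel) by apply: open_borel.
  rewrite nuE; last exact: measurableC.
  apply: (@le_trans _ _ (mu U)); last first.
    by apply: le_trans muU _; rewrite lee_fin; apply: ltW.
  apply: prob_le.
  - rewrite preimage_setC; apply: measurableC; apply: open_borel; apply: open_comp => //.
  - exact: open_borel.
  - move=> y /= nV; apply: contrapT => yU; apply: nV; apply: gV; exists y => //.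
apply: (subbase_nbhs oW Wx FPhi) => _ [f [U [cf oU ->]]] /=.
rewrite Rintegral_dirac // => Ufx.
have : nbhs (f x) U by apply: open_nbhs_nbhs.
move/nbhs_ballP => [e /= e0 eU].
have [V [oV Vx [d d0 hd]]] := integral_concentrated compactX x cf e0.
exists V, d; split=> // nu /hd hnu; apply: eU.
by rewrite /ball /= distrC.
Qed.

End compressible_actions.
Section cover_boundary.
Variables (R : realType) (T : tree) (Omega : finType) (c : colouring T Omega).
Variables (F F' : {group {perm Omega}}) (p0 : cover_point T).
Hypothesis Omega_gt3 : (3 < #|Omega|)%N.

Definition pointed_cover : ptopologicalType :=
  HB.pack (cover_point T) (isPointed.Build (cover_point T) p0).

Lemma half_tree_inhabited x y : adj x y -> exists p : cover_point T, p (half_tree x y).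
Proof.
move=> xy; have [r [rr r0 r1]] := ray_from_edge c Omega_gt3 xy.
have [p [_ pr]] := lies_over_exists c Omega_gt3 rr.
by exists p; have := pr 0%N; rewrite /ahead r0 r1.
Qed.

Lemma cover_boundary :
  @boundary_action (GFF c F F') pointed_cover (fun g => cover_act g) R.
Proof.
have dH x y := @decided_half_tree T Omega c Omega_gt3 x y.
apply: compressible_boundary.
- exact: cover_space_compact.
- exact: cover_space_hausdorff.
- split; [exact: cover_act1|by move=> g h; exact: cover_actM|by move=> g; exact: cover_act_continuous].
- move=> C V cC CT oV V0.
  have [x [y [xy sub]]] : exists x y, adj x y /\ cover_basic (half_tree x y) `<=` ~` C.
    apply: open_cover_half_tree; first exact: closed_openC.
    by apply/set0P/eqP => C0; apply: CT; rewrite -(setCK C) C0 setC0.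
  have [x' [y' [xy' sub']]] := open_cover_half_tree oV V0.
  have [g gH] := half_tree_push c F F' xy xy'; exists g => _ [p Cp <-]; apply: sub'.
  apply: (@cover_up _ p (~` half_tree x y)).
  + by apply: decided_preimage; apply: dH.
  + by move=> v nv; apply: gH; exists v.
  + by case: (cover_ultra p (dH x y xy)) => // /sub.
- move=> V oV V0; have [x [y [xy sub]]] := open_cover_half_tree oV V0.
  have [w [yw subw _ _]] := sub_half_tree c Omega_gt3 y y xy (half_tree_tip xy).
  have [w' [yw' subw' ww' _]] := sub_half_tree c Omega_gt3 w w xy (half_tree_tip xy).
  exists (cover_basic (half_tree y w)), (cover_basic (half_tree y w')); split.
  + by split; apply: open_cover_basic; apply: dH.
  + by split; apply: half_tree_inhabited.
  + by split=> p pH; apply: sub; apply: cover_up pH => //; apply: dH.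
  + apply/seteqP; split=> // p [pw pw'].
    have [v vw] := cover_disjoint pw pw'.
    by move: vw; rewrite half_tree_disjoint // => e; apply: ww'.
Qed.

End cover_boundary.

(** * From finitely additive to regular Borel probabilities *)

Section regular_measure_of_content.
Variables (R : realType) (X : ptopologicalType).
Local Notation borel := (g_sigma_algebraType (@open X)).
Hypothesis compactX : compact [set: X].
Hypothesis hausX : hausdorff_space X.
Variable m : set X -> R.
Hypothesis m_ge0 : forall A, (0 <= m A)%R.
Hypothesis mT : m setT = 1%R.
Hypothesis mU : forall A B, A `&` B = set0 -> m (A `|` B) = (m A + m B)%R.

Local Open Scope ereal_scope.

Lemma content0 : m set0 = 0%R.
Proof. by have := @mU set0 set0 (setI0 _); rewrite setU0; lra. Qed.

Lemma content_le A B : A `<=` B -> (m A <= m B)%R.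
Proof.
move=> AB; rewrite -(setDUK AB) mU ?setDIK //.
by rewrite lerDl.
Qed.

Lemma content_subadditive A B : (m (A `|` B) <= m A + m B)%R.
Proof.
rewrite -(setDUK (@subsetUl _ A B)) mU ?setDIK // lerD2l.
by apply: content_le => x [[]].
Qed.

Definition inner U : \bar R :=
  ereal_sup [set (m K)%:E | K in [set K | closed K /\ K `<=` U]].

Lemma le_inner K U : closed K -> K `<=` U -> (m K)%:E <= inner U.
Proof. by move=> cK KU; apply: ereal_sup_ubound; exists K. Qed.

Lemma inner_le U (x : \bar R) :
  (forall K, closed K -> K `<=` U -> (m K)%:E <= x) -> inner U <= x.
Proof. by move=> h; apply: ge_ereal_sup => _ [K [cK KU] <-]; apply: h. Qed.

Lemma inner_ge0 U : 0 <= inner U.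
Proof. by apply: le_trans (le_inner (@closed0 X) (sub0set U)); rewrite lee_fin. Qed.

Lemma inner_le1 U : inner U <= 1.
Proof. by apply: inner_le => K _ _; rewrite lee_fin -mT; apply: content_le. Qed.

Lemma inner_le_content U : inner U <= (m U)%:E.
Proof. by apply: inner_le => K _ KU; rewrite lee_fin; apply: content_le. Qed.

Lemma inner_mono U V : U `<=` V -> inner U <= inner V.
Proof.
by move=> UV; apply: inner_le => K cK KU; apply: le_inner => //; apply: subset_trans UV.
Qed.

Lemma inner_fin U : inner U \is a fin_num.
Proof.
by rewrite ge0_fin_numE ?inner_ge0 //; apply: le_lt_trans (inner_le1 U) (ltry _).
Qed.

(** By normality, a compact set in a union of two open sets is a union of two
    compact sets, one in each. *)
Lemma inner_setU U V : open U -> open V -> inner (U `|` V) <= inner U + inner V.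
Proof.
move=> oU oV; apply: inner_le => K cK KUV.
have cA : closed (K `\` U) by apply: closedI => //; apply: open_closedC.
have cB : closed (K `\` V) by apply: closedI => //; apply: open_closedC.
have dAB : (K `\` U) `&` (K `\` V) = set0.
  by apply/seteqP; split=> // x [[/KUV[]]] // + nU [_ nV].
have [P [Q [oP oQ AP BQ PQ]]] :=
  (@normal_openP R X).1 (compact_normal hausX compactX) _ _ cA cB dAB.
have cP : closed (K `\` P) by apply: closedI => //; apply: open_closedC.
have cQ : closed (K `\` Q) by apply: closedI => //; apply: open_closedC.
have sP : K `\` P `<=` U by move=> x [Kx nP]; apply: contrapT => nU; apply/nP/AP.
have sQ : K `\` Q `<=` V by move=> x [Kx nQ]; apply: contrapT => nV; apply/nQ/BQ.
apply: le_trans (leeD (le_inner cP sP) (le_inner cQ sQ)).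
rewrite -EFinD lee_fin; apply: le_trans (content_subadditive _ _).
apply: content_le => x Kx; have [Px|nP] := pselect (P x); last by left.
by right; split=> // Qx; have : (P `&` Q) x by []; rewrite PQ.
Qed.

Lemma inner_bigsetU (U : nat -> set X) n : (forall i, open (U i)) ->
  inner (\big[setU/set0]_(i < n) U i) <= \sum_(0 <= i < n) inner (U i).
Proof.
move=> oU; elim: n => [|n IH].
  rewrite big_ord0 big_geq //; apply: inner_le => K _ K0.
  by rewrite lee_fin -content0; apply: content_le.
rewrite big_ord_recr big_nat_recr //=; apply: le_trans (inner_setU _ (oU n)) _.
  by rewrite -bigcup_mkord; apply: bigcup_open.
by rewrite leeD2r.
Qed.

(** A compact subset of the union is covered by finitely many of the sets. *)
Lemma inner_bigcup (U : nat -> set X) : (forall i, open (U i)) ->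
  inner (\bigcup_i U i) <= \sum_(0 <= i <oo) inner (U i).
Proof.
move=> oU; apply: inner_le => K cK KU.
have : compact K by apply: subclosed_compact cK compactX _.
rewrite compact_cover => /(_ _ setT U (fun i _ => oU i) KU)[D _ KD].
pose n := (\max_(i <- D) i).+1.
have Kn : K `<=` \big[setU/set0]_(i < n) U i.
  rewrite -bigcup_mkord => x /KD[i /= iD Ux]; exists i => //=.
  by rewrite ltnS; apply: (@leq_bigmax_seq _ _ xpredT id).
apply: le_trans (le_inner cK Kn) _; apply: le_trans (inner_bigsetU n oU) _.
by apply: nneseries_lim_ge => i _ _; apply: inner_ge0.
Qed.

Definition outer A : \bar R :=
  ereal_inf [set inner U | U in [set U | open U /\ A `<=` U]].

Lemma outer_le U A : open U -> A `<=` U -> outer A <= inner U.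
Proof. by move=> oU AU; apply: ereal_inf_lbound; exists U. Qed.

Lemma le_outer A (x : \bar R) :
  (forall U, open U -> A `<=` U -> x <= inner U) -> x <= outer A.
Proof. by move=> h; apply: le_ereal_inf_tmp => _ [U [oU AU] <-]; apply: h. Qed.

Lemma outer_open U : open U -> outer U = inner U.
Proof.
move=> oU; apply/eqP; rewrite eq_le outer_le //=.
by apply: le_outer => V _; apply: inner_mono.
Qed.

Lemma outer_ge0 A : 0 <= outer A.
Proof. by apply: le_outer => U _ _; apply: inner_ge0. Qed.

Lemma outer_mono A B : A `<=` B -> outer A <= outer B.
Proof.
by move=> AB; apply: le_outer => U oU BU; apply: outer_le => //; apply: subset_trans BU.
Qed.

Lemma outer0 : outer set0 = 0.
Proof.
apply/eqP; rewrite eq_le outer_ge0 andbT outer_open; last exact: open0.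
by apply: inner_le => K _ K0; rewrite lee_fin -content0; apply: content_le.
Qed.

Lemma outer_fin A : outer A \is a fin_num.
Proof.
rewrite ge0_fin_numE ?outer_ge0 //; apply: le_lt_trans (ltry 1).
by apply: le_trans (inner_le1 setT); apply: outer_le => //; apply: openT.
Qed.

Lemma outer_approx A e : (0 < e)%R ->
  exists U, [/\ open U, A `<=` U & inner U <= outer A + e%:E].
Proof.
move=> e0; have [_ [U [oU AU] <-] h] := lb_ereal_inf_adherent e0 (outer_fin A).
by exists U; split=> //; apply: ltW.
Qed.

Lemma outer_sigma_subadditive : sigma_subadditive outer.
Proof.
move=> A; apply/lee_addgt0Pr => e e0.
have /choice[U hU] : forall n, exists U, [/\ open U, A n `<=` U &
    inner U <= outer (A n) + (e / (2 ^ n.+1)%:R)%:E].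
  by move=> n; apply: outer_approx; rewrite divr_gt0 // ltr0n expn_gt0.
apply: le_trans (epsilon_trick xpredT (fun n => outer_ge0 (A n)) (ltW e0)).
apply: (@le_trans _ _ (\sum_(0 <= i <oo) inner (U i))).
  apply: le_trans (inner_bigcup _); last by move=> i; case: (hU i).
  apply: outer_le; first by apply: bigcup_open => i _; case: (hU i).
  by apply: subset_bigcup => i _; case: (hU i).
apply: lee_nneseries => [i _ _|i _]; first exact: inner_ge0.
by case: (hU i).
Qed.

HB.instance Definition _ :=
  isOuterMeasure.Build R X outer outer0 outer_ge0 outer_mono outer_sigma_subadditive.

(** Exhaust [V `&` U] by a compact set [K], then the rest of [V] by a compact set
    disjoint from [K]. *)
Lemma open_caratheodory U : open U -> caratheodory_measurable outer U.
Proof.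
move=> oU; apply: le_caratheodory_measurable => A.
apply/lee_addgt0Pr => e e0; have e2 : (0 < e / 2)%R by rewrite divr_gt0.
apply: (@le_trans _ _ (outer A + (e / 2)%:E + (e / 2)%:E)); last first.
  by rewrite -addeA -EFinD -splitr.
have [V [oV AV hV]] := outer_approx A e2; apply: le_trans (leeD hV (lexx _)).
have oVU : open (V `&` U) by apply: openI.
apply: (@le_trans _ _ (inner (V `&` U) + outer (V `&` ~` U))).
  apply: leeD; last by apply: outer_mono => x [/AV].
  by apply: outer_le => // x [/AV].
have [_ [K [cK KVU] <-] hK] := ub_ereal_sup_adherent e2 (inner_fin (V `&` U)).
have oVK : open (V `&` ~` K) by apply: openI => //; apply: closed_openC.
have hU : outer (V `&` ~` U) <= inner (V `&` ~` K).
  by apply: outer_le => // x [Vx nU]; split=> // /KVU[].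
have step : (m K)%:E + inner (V `&` ~` K) <= inner V.
  rewrite addeC -leeBrDr //; apply: inner_le => L cL LV.
  rewrite leeBrDr // -EFinD -mU; last by apply/seteqP; split=> // x [/LV[_ nK]].
  by apply: le_inner; [apply: closedU|move=> x [/LV[]|/KVU[]]].
have hK' : inner (V `&` U) <= (m K)%:E + (e / 2)%:E.
  by rewrite -leeBlDr //; apply: ltW.
apply: le_trans (leeD hK' hU) _.
by rewrite addeAC leeD2r.
Qed.

Lemma borel_caratheodory (A : set borel) : measurable A -> caratheodory_measurable outer A.
Proof.
apply: (@smallest_sub _ _ _ (caratheodory_measurable outer)) => [|U oU]; last first.
  exact: open_caratheodory.
split.
- exact: caratheodory_measurable_set0.
- by move=> B mB; rewrite setTD; apply: caratheodory_measurable_setC.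
- exact: caratheodory_measurable_bigcup.
Qed.

(** Finitely additive probabilities on all subsets of a compact space regularise
    to regular Borel probabilities, as in the construction of a measure from a
    content on compact sets. *)
Lemma regular_measure_exists : exists mu : Prob R X,
  regular_measure mu /\ forall U, open U -> mu U = inner U.
Proof.
have outer_add : semi_sigma_additive (outer : set borel -> \bar R).
  move=> A mA tA _; apply: (@caratheodory_measure_sigma_additive R X outer A) => //.
    by move=> i; apply: borel_caratheodory.
  by apply: caratheodory_measurable_bigcup => i; apply: borel_caratheodory.
have outerT : outer setT = 1.
  rewrite outer_open; last exact: openT.
  apply/eqP; rewrite eq_le inner_le1 -[X in (X%:E <= _)]mT.
  by apply: le_inner => //; apply: closedT.
have [mu muE] := build_prob outer0 outer_ge0 outer_add outerT.
have muU U : open U -> mu U = inner U by move=> oU; rewrite muE outer_open.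
exists mu; split=> // A mA.
have outerE B : mu B = ereal_inf [set mu U | U in [set U | open U /\ B `<=` U]].
  rewrite muE; congr ereal_inf; apply/seteqP; split=> _ [U [oU BU] <-]; exists U => //.
    exact: muU.
  by rewrite muU.
split; first exact: outerE.
apply/eqP; rewrite eq_le; apply/andP; split; last first.
  apply: ge_ereal_sup => _ [K [cK KA] <-]; apply: prob_le => //.
  by apply: closed_borel; apply: compact_closed.
apply/lee_addgt0Pr => e e0.
have [U [oU AU hU]] := outer_approx (~` A) e0.
rewrite -leeBlDr //; apply: (@le_trans _ _ (mu (~` U))); last first.
  apply: ereal_sup_ubound; exists (~` U) => //; split; last by rewrite -[A]setCK; apply: subsetC.
  by apply: (subclosed_compact _ compactX) => //; apply: open_closedC.
have mUo : measurable (U : set borel) by apply: open_borel.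
rewrite -(muU _ oU) -(muE (~` A)) in hU.
rewrite (probability_setC mu mUo).
rewrite (probability_setC mu mA) in hU.
have fA : mu A \is a fin_num by apply: fin_num_measure.
have fU : mu U \is a fin_num by apply: fin_num_measure.
move: hU; rewrite -(fineK fA) -(fineK fU) -!EFinB -EFinD !lee_fin; lra.
Qed.

End regular_measure_of_content.

(** * Amenability of locally finite groups *)

Section invariant_contents.
Variables (R : realType) (G : groupType) (X : Type) (act : G -> X -> X) (b : X).
Hypothesis actM : forall g h x, act (g * h)%g x = act g (act h x).
Variable K : set G.
Hypothesis locally_finite : forall s : seq G, (forall g, g \in s -> K g) ->
  exists L : seq G, [/\ L != [::], forall h, h \in L -> K h &
    forall g, g \in s -> perm_eq [seq (g * h)%g | h <- L] L].
Local Open Scope ring_scope.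

Let average (L : seq G) (A : set X) : R :=
  (count (fun h => `[< A (act h b) >]) L)%:R / (size L)%:R.

Let average_itv L A : average L A \in `[0, 1].
Proof.
rewrite in_itv /= divr_ge0 //=; have [s0|L0] := eqVneq (size L) 0%N.
  by rewrite /average s0 invr0 mulr0 ler01.
by rewrite /average ler_pdivrMr ?ltr0n ?lt0n // mul1r ler_nat count_size.
Qed.

Let average_setU L A B : A `&` B = set0 -> average L (A `|` B) = average L A + average L B.
Proof.
move=> AB; rewrite /average -mulrDl -natrD; congr (_%:R / _).
rewrite -count_predUI (@eq_count _ (predI _ _) pred0) ?count_pred0 ?addn0.
  by apply: eq_count => h /=; apply/asboolP/orP => -[] => [/asboolP|/asboolP|/asboolP|/asboolP]; by [left|right].
move=> h /=; apply/negbTE/negP => /andP[/asboolP hA /asboolP hB].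
by have : (A `&` B) (act h b) by []; rewrite AB.
Qed.

(** A locally finite group is amenable: take a limit of averages over larger and
    larger finite sets that are invariant under more and more elements. *)
Lemma invariant_content : exists m : set X -> R,
  [/\ forall A, 0 <= m A,
      forall A, (forall h, K h -> A (act h b)) -> m A = 1,
      forall A B, A `&` B = set0 -> m (A `|` B) = m A + m B
    & forall g, K g -> forall A, m (act g @^-1` A) = m A].
Proof.
have /choice[L hL] : forall s : seq G, exists L, (forall g, g \in s -> K g) ->
    [/\ L != [::], forall h, h \in L -> K h &
      forall g, g \in s -> perm_eq [seq (g * h)%g | h <- L] L].
  move=> s; have [/locally_finite[L]|no] := pselect (forall g, g \in s -> K g).
    by exists L.
  by exists [::].
pose Phi := [set P : set (seq G) | exists2 s0 : seq G, (forall g, g \in s0 -> K g) &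
  forall s : seq G, (forall g, g \in s -> K g) -> {subset s0 <= s} -> P s].
have PPhi : ProperFilter Phi.
  split; first by case=> s0 Ks0 /(_ s0 Ks0 (fun _ h => h)).
  split; first by exists [::].
  - move=> P Q [s1 K1 h1] [s2 K2 h2]; exists (s1 ++ s2).
      by move=> g; rewrite mem_cat => /orP[/K1|/K2].
    move=> s Ks sub; split; [apply: h1|apply: h2] => // g gs; apply: sub;
      by rewrite mem_cat gs ?orbT.
  - by move=> P Q PQ [s0 K0 h0]; exists s0 => // s Ks sub; apply/PQ/h0.
have [U [UU PU]] := ultraFilterLemma PPhi.
have PUU : ProperFilter U by apply: ultra_proper.
have /choice[m hm] : forall A, exists l : R, average (L s) A @[s --> U] --> l.
  move=> A; have PA : ProperFilter (average (L s) A @[s --> U]) by apply: fmap_proper_filter.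
  have [|l [_ lcl]] := @segment_compact R 0 1 _ PA.
    by rewrite /= /fmap /=; apply: filterE => s; apply: average_itv.
  exists l => W Wl; rewrite /= /fmap /=.
  have [//|nW] := in_ultra_setVsetC ((fun s => average (L s) A) @^-1` W) UU.
  by have [y []] := lcl (~` W) W nW Wl.
have limE A (l : R) : (\forall s \near U, average (L s) A = l) -> m A = l.
  move=> nl; apply: (cvg_unique (@norm_hausdorff _ R) (hm A)).
  by apply: cvg_near_cst.
have Keventually (P : set (seq G)) : (forall s : seq G, (forall g, g \in s -> K g) -> P s) -> U P.
  by move=> h; apply: PU; exists [::] => // s Ks _; apply: h.
exists m; split.
- by move=> A; apply: (cvgr_to_ge (hm A)); apply: filterE => s;
    have := average_itv (L s) A; rewrite in_itv /= => /andP[].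
- move=> A KA; apply/limE/Keventually => s Ks; have [L0 LK _] := hL s Ks.
  rewrite /average (_ : count _ _ = size (L s)) ?divff ?pnatr_eq0 ?size_eq0 //.
  by apply/eqP; rewrite -all_count; apply/allP => h /LK/KA hA; apply/asboolP.
- move=> A B AB; apply: (cvg_unique (@norm_hausdorff _ R) (hm _)).
  rewrite /= (_ : (fun s => _) = fun s => average (L s) A + average (L s) B).
    exact: cvgD (hm A) (hm B).
  by apply/funext => s; rewrite average_setU.
- move=> g Kg A; apply: (cvg_unique (@norm_hausdorff _ R) (hm _)).
  suff near_eq : \forall s \near U, average (L s) A = average (L s) (act g @^-1` A).
    exact: cvg_trans (near_eq_cvg near_eq) (hm A).
  apply: PU; exists [:: g] => [h|s Ks]; first by rewrite inE => /eqP ->.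
  have [_ _ Linv] := hL s Ks => /(_ g (mem_head _ _))/Linv/seq.permP/(_ (fun h => `[< A (act h b) >])) pL.
  rewrite /average -pL count_map; congr (_%:R / _); apply: eq_count => h /=.
  by rewrite actM.
Qed.

End invariant_contents.
Section ray_fixators.
Variables (T : tree) (Omega : finType) (c : colouring T Omega).
Variables (F F' : {group {perm Omega}}).
Hypothesis Ffree : acts_freely F.
Implicit Types (u v w x y : T) (r s : nat -> T).
Local Notation G := (GFF c F F').

Definition tail_fixator r : set G := [set g : G | exists n, fixes_on g (ahead r n)].

Let near_singular v D : set G :=
  [set g : G | g v = v /\ forall u, (D < dist v u)%N -> local_perm c g u \in F].

Let portrait v D (g : G) : {ffun D.-bseq Omega -> {perm Omega}} :=
  [ffun w : D.-bseq Omega => local_perm c g (walk c v w)].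

(** Away from the singularities the action of an element is determined by its
    action nearer to the fixed vertex. *)
Lemma portrait_inj v D : {in near_singular v D &, injective (portrait v D)}.
Proof.
move=> g h /set_mem[gv gF] /set_mem[hv hF] gh; apply: val_inj; apply: tree_autP => u.
move En: (dist v u) => n; elim/ltn_ind: n u En => n IH u En /=.
have [<-|vu] := eqVneq v u; first by rewrite [LHS]gv [RHS]hv.
have [w uw dw] := closer_exists vu; have wu : adj w u by rewrite adj_sym.
have gw : g w = h w by apply: (IH (dist v w)) => //; lia.
rewrite -(nbr_colour c wu) !aut_nbr gw; suff -> : local_perm c g w = local_perm c h w by [].
have [near|far] := leqP (dist v w) D.
  have [s sw ss] := walk_reach c v w.
  have sD : (size s <= D)%N by rewrite ss.
  have /ffunP/(_ (Bseq sD)) := gh.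
  by rewrite !ffunE /= sw.
have vw : v != w by apply/eqP => e; rewrite -e distxx in far.
have [x wx dx] := closer_exists vw.
apply: (same_local_perm Ffree wx) => //; [exact: gF|exact: hF|].
by apply: (IH (dist v x)) => //; lia.
Qed.

Lemma near_singular_finite v D : finite_set (near_singular v D).
Proof.
rewrite -(eq_finite_set (inj_card_eq (@portrait_inj v D))).
exact: finite_finset.
Qed.

Lemma near_singular_mul v D g h : near_singular v D g -> near_singular v D h ->
  near_singular v D (g * h)%g.
Proof.
move=> [gv gF] [hv hF]; split=> [|u far]; first by rewrite /= hv.
rewrite local_permM groupM ?hF //; apply: gF.
by rewrite -[X in dist X _]hv aut_dist.
Qed.

Lemma near_singular_exists v (g : G) : g v = v -> exists D, near_singular v D g.
Proof.
move=> gv; suff [D hD] : exists D, forall u, (D < dist v u)%N -> local_perm c g u \in F.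
  by exists D.
case: g {gv} => g /= /asboolP[_ /finite_seqP[S eS]].
exists (\max_(u <- S) dist v u)%N => u far; apply/negPn/negP => gu.
have uS : u \in S by have : [set v | local_perm c g v \notin F] u by []; rewrite eS.
by have := @leq_bigmax_seq _ S xpredT (dist v) u uS isT; rewrite leqNgt far.
Qed.

(** Finitely many elements fix a common half-tree and have all their
    singularities in a common ball, and there are only finitely many such
    elements. *)
Lemma tail_fixator_locally_finite r : ray r -> forall s : seq G,
  (forall g, g \in s -> tail_fixator r g) ->
  exists L : seq G, [/\ L != [::], forall h, h \in L -> tail_fixator r h &
    forall g, g \in s -> perm_eq [seq (g * h)%g | h <- L] L].
Proof.
move=> rr s sK.
have [n sn] : exists n, forall g, g \in s -> fixes_on g (ahead r n).
  elim: s sK => [|g s IH] sK; first by exists 0%N.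
  have [|n hn] := IH; first by move=> h hs; apply: sK; rewrite inE hs orbT.
  have [m hm] := sK g (mem_head _ _); exists (maxn n m) => h.
  rewrite inE => /orP[/eqP -> v hv|hs v hv].
    by apply: hm; move: v hv; apply: ahead_decr => //; lia.
  by apply: (hn h hs); move: v hv; apply: ahead_decr => //; lia.
pose v := r n.+1; have vn : ahead r n v by apply/ahead_rayP.
have [D sD] : exists D, forall g, g \in s -> near_singular v D g.
  elim: s sn {sK} => [|g s IH] sn; first by exists 0%N.
  have [|D hD] := IH; first by move=> h hs; apply: sn; rewrite inE hs orbT.
  have gv : g v = v by apply: (sn g (mem_head _ _)).
  have [E [_ hE]] := near_singular_exists gv; exists (maxn D E) => h.
  rewrite inE => /orP[/eqP ->|hs].
    by split=> // u far; apply: hE; lia.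
  by have [hv hF] := hD h hs; split=> // u far; apply: hF; lia.
pose Gamma := near_singular v D `&` [set g : G | fixes_on g (ahead r n)].
have /finite_seqP[L0 eL0] : finite_set Gamma.
  by apply: sub_finite_set (near_singular_finite v D) => g [].
have inL h : h \in undup L0 <-> Gamma h by rewrite mem_undup eL0.
have one : Gamma 1%g by split=> //; split=> // u _; rewrite local_perm1 group1.
exists (undup L0); split.
- by apply/eqP => L0e; have /inL := one; rewrite L0e.
- by move=> h /inL[_ hn]; exists n.
move=> g gs; apply: uniq_perm.
- by rewrite map_inj_uniq ?undup_uniq //; apply: mulgI.
- exact: undup_uniq.
apply: (uniq_min_size _ _ _).2 => //.
- by rewrite map_inj_uniq ?undup_uniq //; apply: mulgI.
- move=> _ /mapP[h /inL[hD hn] ->]; apply/inL; split.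
    by apply: near_singular_mul => //; apply: sD.
  by move=> u hu /=; rewrite hn //; apply: sn.
- by rewrite size_map.
Qed.

End ray_fixators.
Section group_elements.
Variables (T : tree) (Omega : finType) (c : colouring T Omega).
Variables (F F' : {group {perm Omega}}).
Implicit Types (g : GFF c F F') (v : T).

Lemma GFF_mulVK g v : g (g^-1%g v) = v.
Proof. by rewrite -[LHS]/((g * g^-1)%g v) mulgV. Qed.

Lemma GFF_mulKV g v : g^-1%g (g v) = v.
Proof. by rewrite -[LHS]/((g^-1 * g)%g v) mulVg. Qed.

End group_elements.

(** * Stabilizers in the Furstenberg boundary *)

Section factors_of_the_boundary.
Variables (R : realType) (T : tree) (Omega : finType) (c : colouring T Omega).
Variables (F F' : {group {perm Omega}}) (B : ptopologicalType).
Variable act : GFF c F F' -> B -> B.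
Hypothesis Omega_gt3 : (3 < #|Omega|)%N.
Hypothesis Ffree : acts_freely F.
Hypothesis boundaryB : boundary_action act R.
Variables (p0 : cover_point T) (rho : B -> pointed_cover p0).
Hypothesis rho_cont : continuous rho.
Hypothesis rho_surj : forall p : cover_point T, exists b, rho b = p.
Hypothesis rho_act : forall g b, rho (act g b) = cover_act g (rho b).
Local Open Scope ring_scope.

Let over (b : B) : cover_point T := rho b.

Lemma open_over x y : adj x y -> open [set b | over b (half_tree x y)].
Proof.
move=> xy; apply: (@open_comp _ _ rho (cover_basic (half_tree x y))) => //.
by apply: open_cover_basic; apply: (decided_half_tree c Omega_gt3).
Qed.

(** On the fibre over the end of [r] there is a probability invariant under the
    locally finite group [tail_fixator r]. If [act g] moved a small open set [V]
    above the half-tree off itself, contracting this probability into [V] would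
    leave it invariant under [g], giving both [V] and its disjoint translate
    more than half of the mass. *)
Lemma half_tree_fixes_fibre (g : GFF c F F') x y b : adj x y ->
  fixes_on g (half_tree x y) -> over b (half_tree x y) -> act g b = b.
Proof.
move=> xy gH bH; apply: contrapT => gb.
have [cptB hausB [act1 actM act_cont] minB proxB] := boundaryB.
have [V [oV Vb VH gV]] : exists V : set B, [/\ open V, V b,
    forall z, V z -> over z (half_tree x y) & forall z, V z -> ~ V (act g z)].
  have : b != act g b by apply/eqP => e; apply: gb.
  have haus := hausB; rewrite open_hausdorff in haus.
  move=> /haus[[A1 A2] /= [/set_mem A1b /set_mem A2b] [oA1 oA2 /eqP A12]].
  exists ([set z | over z (half_tree x y)] `&` (A1 `&` act g @^-1` A2)); split=> //.
  - apply: openI; first exact: open_over.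
    by apply: openI => //; apply: open_comp => // z _; apply: act_cont.
  - by move=> z [].
  - move=> z [_ [_ A2z]] [_ [A1z _]].
    by have : (A1 `&` A2) (act g z) by []; rewrite A12.
have [r [rr r0 r1]] := ray_from_edge c Omega_gt3 xy.
have [p pr] := lies_over_exists c Omega_gt3 rr.
have [b0 b0p] := rho_surj p.
have [m [m_ge0 m1 mU m_inv]] := @invariant_content R _ _ act b0 actM (@tail_fixator _ _ c F F' r)
  (tail_fixator_locally_finite Ffree rr).
have mT : m setT = 1 by apply: m1.
have m_over n : m [set z | over z (ahead r n)] = 1.
  apply: m1 => h [N hN] /=; rewrite /over rho_act b0p.
  have := lies_over_act h pr => /(lies_over_end c Omega_gt3)/(_ rr (fixes_ahead_tail rr hN)).
  by case.
have [mu [mu_reg muE]] := regular_measure_exists cptB hausB m_ge0 mT mU.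
have [x0 x0P] := proxB mu mu_reg.
have [z0 [Vz0 [h _ hz0]]] : V `&` range (fun h => act h x0) !=set0.
  by apply: minB => //; exists b.
have Vh : V (act h x0) by rewrite hz0.
have [f [cf f01 f0 f1]] : exists f : B -> R, [/\ continuous f,
    forall z, 0 <= f z <= 1, forall z, ~ V z -> f z = 0 & f (act h x0) = 1].
  have cV : closed (~` V) by apply: open_closedC.
  have cx : closed [set act h x0].
    exact: accessible_closed_set1 (hausdorff_accessible hausB) _.
  have dis : ~` V `&` [set act h x0] = set0.
    by apply/seteqP; split=> // z [nV zx]; apply: nV; rewrite zx.
  have := (@normal_separatorP R B).1 (compact_normal hausB cptB) _ _ cV cx dis.
  move=> /(@uniform_separatorP _ R)[f [cf f01 f0 f1]]; exists f; split=> //.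
  - by move=> z; have := f01 (f z) (ex_intro2 _ _ z Logic.I erefl); rewrite /= in_itv.
  - by move=> z nV; apply: (f0 (f z)); exists z.
  - by apply: (f1 (f (act h x0))); exists (act h x0).
have cfh : continuous (f \o act h).
  by move=> z; apply: continuous_comp; [apply: act_cont|apply: cf].
pose W := [set nu : Prob R B | `]1 / 2, +oo[%classic (\int[nu]_z (f \o act h) z)].
have oW : open W.
  apply: (@subbase_open _ _ (@weak_star_subbase R B) id).
  by exists (f \o act h), `]1 / 2, +oo[%classic; split.
have Wx0 : W (dirac_prob R x0).
  by rewrite /W /= Rintegral_dirac //= f1 in_itv /= andbT; lra.
have [nu [[h' nuE] Wnu]] := x0P W (open_nbhs_nbhs (conj oW Wx0)).
(* [nu] is the translate of [mu] by [h'], so [k] carries most of [mu] into [V]. *)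
pose k := (h * h')%g.
pose U := act k @^-1` V.
have oact t (A : set B) : open A -> open (act t @^-1` A).
  by move=> oA; apply: open_comp => // z _; apply: act_cont.
have oU : open U by apply: oact.
have halfU : ((1 / 2)%:E < mu U)%E.
  have ohV : open (act h @^-1` V) by apply: oact.
  have -> : mu U = nu (act h @^-1` V).
    rewrite nuE; last exact: open_borel.
    by congr (mu _); apply/seteqP; split=> z; rewrite /U /k /= actM.
  have mhV := open_borel ohV.
  have nfin : nu (act h @^-1` V) \is a fin_num by apply: fin_num_measure.
  rewrite -(fineK nfin) lte_fin -Rintegral_indic //.
  move: Wnu; rewrite /W /= in_itv /= andbT => /lt_le_trans; apply.
  apply: le_Rintegral => //; [exact: continuous_integrable|exact: indic_integrable|].
  move=> z _ /=; rewrite indicE; have [Vz|nV] := pselect (V (act h z)).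
    by rewrite mem_set //; case/andP: (f01 (act h z)).
  by rewrite memNset // f0.
(* If the end of [r] were outside the translated half-tree, then so would be the
   support of [mu]. *)
have [N rN] : exists N, ahead r N `<=` half_tree (k^-1%g x) (k^-1%g y).
  have kxy : adj ((k^-1)%g x) ((k^-1)%g y) by rewrite aut_adj.
  have [N [sub|sub]] := ahead_side rr kxy; first by exists N.
  have : mu U = 0%E.
    apply/eqP; rewrite eq_le measure_ge0 andbT muE //.
    apply: le_trans (inner_le_content m_ge0 mU U) _; rewrite lee_fin.
    have := m_over N; set A := [set z | _] => mA.
    have mAC : m (~` A) = 0.
      have := mU A (~` A) (setICr A); rewrite setUv mT mA; lra.
    rewrite -mAC; apply: content_le => // z Uz Az.
    have := VH _ Uz; rewrite /over rho_act.
    have -> : half_tree x y = half_tree (k ((k^-1)%g x)) (k ((k^-1)%g y)).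
      by rewrite !GFF_mulVK.
    rewrite cover_act_half_tree // => zH.
    have [v [vH /sub]] := cover_disjoint zH Az.
    by rewrite -half_treeC.
  by move=> mu0; exfalso; move: halfU; rewrite mu0 lte_fin; lra.
pose t := (k^-1 * g * k)%g.
have tK : @tail_fixator _ _ c F F' r t.
  exists N => v /rN vH; have gkv : g (k v) = k v.
    apply: gH; rewrite -[x](GFF_mulVK k) -[y](GFF_mulVK k).
    by rewrite -aut_half_tree ?aut_adj //; exists v.
  by rewrite -[LHS]/(k^-1%g (g (k v))) gkv GFF_mulKV.
have U'le : (mu U <= mu (act t @^-1` U))%E.
  rewrite !muE //; last exact: oact.
  apply: inner_le => C cC CU; rewrite -(m_inv t tK C).
  by apply: le_inner; [apply: closed_comp => // z _; apply: act_cont|move=> z /CU].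
have dis : U `&` (act t @^-1` U) = set0.
  apply/seteqP; split=> // z [Uz Utz]; have : V (act k (act t z)) by [].
  have kt : (k * t = g * k)%g by rewrite /t -(mulgA _ g k) mulKVg.
  by rewrite -actM kt actM => hV; case: (gV _ Uz hV).
have : (mu U + mu (act t @^-1` U) <= 1)%E.
  rewrite -measureU //; [|exact: open_borel|by apply: open_borel; apply: oact].
  by apply: probability_le1; apply: open_borel; apply: openU => //; apply: oact.
have := lt_le_trans halfU U'le; have := halfU.
have f1' : mu U \is a fin_num by apply: fin_num_measure; apply: open_borel.
have f2' : mu (act t @^-1` U) \is a fin_num.
  by apply: fin_num_measure; apply: open_borel; apply: oact.
rewrite -(fineK f1') -(fineK f2') -EFinD !lte_fin lee_fin; lra.
Qed.

Lemma fixes_over (g : GFF c F F') b r : lies_over (over b) r ->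
  act g b = b <-> exists N, fixes_on g (ahead r N).
Proof.
move=> br; have rr := br.1; split=> [gb|[N gN]].
  have gp : cover_act g (over b) = over b by rewrite -[RHS]/(rho b) -{2}gb rho_act.
  have [M hM] := elliptic_fixes_tail (cover_fixed_elliptic c Omega_gt3 gp) rr
    (cover_fixed_cofinal br gp).
  exact (fixes_tail_ahead Ffree rr hM).
exact: half_tree_fixes_fibre (ray_adj N rr) gN (br.2 N).
Qed.

End factors_of_the_boundary.

Theorem corollary4p29 (R : realType) (Omega : finType)
    (T : tree) (c : colouring T Omega) (F F' : {group {perm Omega}})
    (B : ptopologicalType) (act : GFF c F F' -> B -> B) :
  (3 < #|Omega|)%N ->
  F \subset F' ->
  acts_freely F ->
  regular_tree #|Omega| T ->
  furstenberg_boundary R act ->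
  [set point_stabilizer act b | b in [set: B]] =
    [set germ_stabilizer xi | xi in [set: tree_end T]] /\
  forall g : GFF c F F',
    ((exists b : B, act g b = b) <-> fixes_half_tree g) /\
    ((exists b : B, act g b = b) <->
       elliptic g /\ exists xi : tree_end T, end_map g xi = xi).
Proof.
move=> Omega_gt3 _ Ffree _ [boundaryB universalB].
have [p0 _] : exists p0 : cover_point T, True.
  case: (tree_nonempty T) => v; have [w [vw _ _ _]] := other_nbr c Omega_gt3 v v v v.
  by have [p _] := half_tree_inhabited c Omega_gt3 vw; exists p.
have [rho [rho_cont rho_onto rho_act]] :=
  universalB _ _ (@cover_boundary R T Omega c F F' p0 Omega_gt3).
have rho_surj (p : cover_point T) : exists b, rho b = p.
  by have [b _ <-] := rho_onto p Logic.I; exists b.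
have fixP := fixes_over Omega_gt3 Ffree boundaryB rho_cont rho_surj rho_act.
have germP (g : GFF c F F') xi r : end_rays xi r ->
    germ_stabilizer xi g <-> exists N, fixes_on g (ahead r N).
  move=> xr; have rr := end_rays_ray xr; split=> [near|[N gN]]; last first.
    exact: fixes_ahead_germ xr gN.
  have [M hM] := germ_fixes_tail c Omega_gt3 xr near.
  exact (fixes_tail_ahead Ffree rr hM).
have stabE b xi r : end_rays xi r -> lies_over (rho b) r ->
    point_stabilizer act b = germ_stabilizer xi.
  move=> xr br; apply/seteqP; split=> g.
    by move/(fixP g b r br)/(germP g xi r xr).
  by move/(germP g xi r xr)/(fixP g b r br).
have over_ray r : ray r -> exists b, lies_over (rho b) r.
  move=> rr; have [p pr] := lies_over_exists c Omega_gt3 rr.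
  by have [b bp] := rho_surj p; exists b; rewrite bp.
split.
  apply/seteqP; split=> [_ [b _ <-]|_ [xi _ <-]].
    have [r br] := cover_ray c Omega_gt3 (rho b).
    by exists (end_of_ray br.1) => //; rewrite (stabE b _ r (end_of_rayP br.1) br).
  have [r rr xr] := end_ray xi; have [b br] := over_ray r rr.
  by exists b => //; apply: stabE br.
move=> g; split; split.
- move=> [b gb]; have [r br] := cover_ray c Omega_gt3 (rho b).
  have [N gN] := (fixP g b r br).1 gb.
  by exists (ahead r N) => //; exists (r N), (r N.+1); split=> //; apply: ray_adj br.1.
- move=> [_ [x [y [xy ->]]] gH]; have [r [rr r0 r1]] := ray_from_edge c Omega_gt3 xy.
  have [b br] := over_ray r rr; exists b; apply/(fixP g b r br); exists 0%N.
  by rewrite /ahead r0 r1.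
- move=> [b gb]; have [r br] := cover_ray c Omega_gt3 (rho b).
  have gp : cover_act g (rho b) = rho b by rewrite -{2}gb rho_act.
  split; first exact (cover_fixed_elliptic c Omega_gt3 gp).
  exists (end_of_ray br.1); apply: cofinal_fixes_end (end_of_rayP br.1) _.
  exact: cover_fixed_cofinal br gp.
- move=> [ell [xi gxi]]; have [r rr xr] := end_ray xi.
  have [M hM] := elliptic_fixes_tail ell rr (fixes_end xr gxi).
  have [b br] := over_ray r rr; exists b; apply/(fixP g b r br).
  exact (fixes_tail_ahead Ffree rr hM).
Qed.
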